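(* Let $0<k<1$ and let $w$ be a real number such that $w/K$ is irrational. Let $P_n(x)$, $n=0,1,2,\dots$, be the monic polynomials defined by $P_{-1}=0$, $P_0=1$ and $$P_{n+1}(x)+b_nP_n(x)+u_nP_{n-1}(x)=xP_n(x),$$ where $$u_n=\frac{\mathrm{sn}^2(w(2n-1))\,(1-\mathrm{dn}(2wn))\,(1+\mathrm{dn}(2w(n-1)))}{4},$$ $$b_n=\frac{\mathrm{cn}(w(2n+1))(1+\mathrm{dn}(2wn))-\mathrm{cn}(w(2n-1))(1-\mathrm{dn}(2wn))}{2}.$$ Then these polynomials have the explicit expression $$P_n(x)=\frac{(-1)^n2^{1-n}}{1+\mathrm{dn}(2wn)}\left(\mathrm{dn}(wn)E_n^{2n}+\sum_{s=1}^n(-1)^sE_{n+s}^{2n}\bigl(\mathrm{dn}(w(n-s))+\mathrm{dn}(w(n+s))\bigr)T_s(x)\right),$$ and they satisfy the orthogonality relation $$\sum_{s=-\infty}^{\infty}\rho_s\,P_n(x_s)P_m(x_s)=H_n\,\delta_{nm},\qquad H_n=u_1u_2\cdots u_n,\qquad n,m=0,1,2,\dots,$$ where $$x_s=\cos\Bigl(\frac{\pi w(s-1/2)}{K}\Bigr),\qquad \rho_s=\frac{\pi}{kK}\,\frac{1}{q^{s-1/2}+q^{-s+1/2}},$$ and the set of spectral points $x_s$, $s\in\mathbb{Z}$, is dense in $[-1,1]$.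
   Context: The functions $\mathrm{sn},\mathrm{cn},\mathrm{dn}$ are the Jacobi elliptic functions with modulus $k$. $K=K(k)$ is the complete elliptic integral of the first kind, $K'=K(k')$ with $k'^2=1-k^2$, and $q=\exp(-\pi K'/K)$. $T_s$ is the Chebyshev polynomial of the first kind, $T_s(\cos\theta)=\cos(s\theta)$. The empty product $H_0$ equals $1$. The elliptic binomial coefficients are $$E_0^n=1,\qquad E_j^n=\prod_{s=0}^{j-1}\frac{\mathrm{sn}(w(n-s))}{\mathrm{sn}(w(s+1))}\quad(0\le j\le n),$$ and $E_j^n=0$ otherwise. *)

(* Defs.v *)
From Stdlib Require Import Reals Qreals ZArith Lra Lia Psatz.
From Coquelicot Require Import Coquelicot.
Open Scope R_scope.

(** * Jacobi elliptic functions of a real argument, with modulus [k] *)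

Definition ellF (k phi : R) : R :=
  RInt (fun t => / sqrt (1 - k ^ 2 * sin t ^ 2)) 0 phi.

Definition ellK (k : R) : R := ellF k (PI / 2).

(** The unique real [phi] with [ellF k phi = u]; it exists for [0 < k < 1] by
    [ellF_bijective], so [iota] is not used outside its specification there. *)
Definition am (k u : R) : R := iota (fun phi : R => ellF k phi = u).

Definition sn (k u : R) : R := sin (am k u).
Definition cn (k u : R) : R := cos (am k u).
(** On the real line [dn] is positive, whence the choice of square root. *)
Definition dn (k u : R) : R := sqrt (1 - k ^ 2 * sn k u ^ 2).

Definition nome (k : R) : R :=
  exp (- PI * ellK (sqrt (1 - k ^ 2)) / ellK k).

(** * General notions *)

Definition irrational (x : R) : Prop := ~ exists r : Q, x = Q2R r.

(** Product of [f 0, ..., f (n - 1)]. *)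
Fixpoint prod_lt (f : nat -> R) (n : nat) : R :=
  match n with
  | O => 1
  | S m => prod_lt f m * f m
  end.

Fixpoint Cheb (s : nat) (x : R) : R :=
  match s with
  | O => 1
  | S s1 => match s1 with
            | O => x
            | S s2 => 2 * x * Cheb s1 x - Cheb s2 x
            end
  end.

(** The bilateral series converges, to [l], when its parts over [s >= 0] and
    over [s < 0] converge separately and their sums add up to [l]. *)
Definition is_bilateral_series (a : Z -> R) (l : R) : Prop :=
  exists l1 l2 : R,
    is_series (fun n : nat => a (Z.of_nat n)) l1 /\
    is_series (fun n : nat => a (- Z.of_nat (S n))%Z) l2 /\
    l = l1 + l2.

(** [D] is a subset of [X] and every point of [X] is adherent to [D]. *)
Definition dense_in (D X : R -> Prop) : Prop :=
  included D X /\ included X (adherence D).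

(** * Elliptic binomial coefficients and the polynomials *)

Definition ellbinom (k w : R) (n j : nat) : R :=
  if (j <=? n)%nat then
    prod_lt (fun s => sn k (w * (INR n - INR s)) / sn k (w * (INR s + 1))) j
  else 0.

Definition coef_u (k w : R) (n : nat) : R :=
  sn k (w * (2 * INR n - 1)) ^ 2
  * (1 - dn k (2 * w * INR n))
  * (1 + dn k (2 * w * (INR n - 1))) / 4.

Definition coef_b (k w : R) (n : nat) : R :=
  (cn k (w * (2 * INR n + 1)) * (1 + dn k (2 * w * INR n))
   - cn k (w * (2 * INR n - 1)) * (1 - dn k (2 * w * INR n))) / 2.

(** The recurrence solved for its leading term; the inner [0] is the initial
    value [P_{-1} = 0]. *)
Fixpoint P (k w : R) (n : nat) (x : R) : R :=
  match n with
  | O => 1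
  | S m => (x - coef_b k w m) * P k w m x
           - coef_u k w m * match m with O => 0 | S l => P k w l x end
  end.

Definition Hnorm (k w : R) (n : nat) : R :=
  prod_lt (fun i => coef_u k w (S i)) n.

Definition node (k w : R) (s : Z) : R :=
  cos (PI * w * (IZR s - / 2) / ellK k).

Definition weight (k : R) (s : Z) : R :=
  PI / (k * ellK k)
  * / (Rpower (nome k) (IZR s - / 2) + Rpower (nome k) (- IZR s + / 2)).

(** * Well-definedness *)

Lemma ellF_radicand (k t : R) :
  0 < k < 1 -> 0 < 1 - k ^ 2 * sin t ^ 2 <= 1.
Proof.
  intros [k0 k1].
  assert (Hs := sin2_cos2 t). unfold Rsqr in Hs.
  assert (0 <= sin t ^ 2 <= 1) by nra.
  assert (0 < k ^ 2 < 1) by nra.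
  split; nra.
Qed.

Lemma ellF_continuous_integrand (k t : R) :
  0 < k < 1 -> continuous (fun t => / sqrt (1 - k ^ 2 * sin t ^ 2)) t.
Proof.
  intros Hk. destruct (ellF_radicand k t Hk) as [H0 _].
  apply (ex_derive_continuous (fun t => / sqrt (1 - k ^ 2 * sin t ^ 2))).
  auto_derive. repeat split; simpl in *; try lra.
  apply Rgt_not_eq, sqrt_lt_R0. lra.
Qed.

Lemma ellF_derive (k phi : R) :
  0 < k < 1 -> is_derive (ellF k) phi (/ sqrt (1 - k ^ 2 * sin phi ^ 2)).
Proof.
  intros Hk. unfold ellF.
  apply (is_derive_RInt (fun t => / sqrt (1 - k ^ 2 * sin t ^ 2)) _ 0).
  - apply filter_forall. intros y. apply (RInt_correct (V := R_CompleteNormedModule)).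
    apply (ex_RInt_continuous (V := R_CompleteNormedModule)).
    intros z _. now apply ellF_continuous_integrand.
  - now apply ellF_continuous_integrand.
Qed.

Lemma ellF_increment (k a b : R) :
  0 < k < 1 -> a <= b -> b - a <= ellF k b - ellF k a.
Proof.
  intros Hk Hab.
  destruct (MVT_gen (ellF k) a b (fun t => / sqrt (1 - k ^ 2 * sin t ^ 2)))
    as [c [_ Hc]].
  - intros x _. now apply ellF_derive.
  - intros x _. apply derivable_continuous_pt.
    exists (/ sqrt (1 - k ^ 2 * sin x ^ 2)).
    now apply is_derive_Reals, ellF_derive.
  - rewrite Hc. destruct (ellF_radicand k c Hk) as [H0 H1].
    assert (1 <= / sqrt (1 - k ^ 2 * sin c ^ 2)).
    { rewrite <- Rinv_1 at 1. apply Rinv_le_contravar.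
      - now apply sqrt_lt_R0.
      - rewrite <- sqrt_1 at 2. now apply sqrt_le_1_alt. }
    nra.
Qed.

Lemma ellF_bijective (k u : R) :
  0 < k < 1 -> exists! phi : R, ellF k phi = u.
Proof.
  intros Hk.
  assert (F0 : ellF k 0 = 0) by (unfold ellF; apply (RInt_point (V := R_CompleteNormedModule))).
  set (M := Rabs u + 1).
  assert (HM := Rle_abs u). assert (HM' := Rle_abs (- u)).
  rewrite Rabs_Ropp in HM'.
  assert (HM0 := Rabs_pos u).
  assert (L := ellF_increment k (- M) 0 Hk ltac:(unfold M; lra)).
  assert (U := ellF_increment k 0 M Hk ltac:(unfold M; lra)).
  destruct (IVT (fun x => ellF k x - u) (- M) M) as [phi [_ Hphi]].
  - intros x. apply derivable_continuous_pt.
    exists (/ sqrt (1 - k ^ 2 * sin x ^ 2)).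
    apply is_derive_Reals.
    replace (/ sqrt (1 - k ^ 2 * sin x ^ 2))
      with (minus (/ sqrt (1 - k ^ 2 * sin x ^ 2)) 0)
      by (unfold minus, plus, opp; simpl; ring).
    apply (is_derive_minus (ellF k) (fun _ => u)).
    + now apply ellF_derive.
    + apply @is_derive_const.
  - unfold M; lra.
  - unfold M in *; lra.
  - unfold M in *; lra.
  - exists phi. split; [lra|].
    intros psi Hpsi.
    destruct (Rle_dec phi psi) as [h | h].
    + assert (I := ellF_increment k phi psi Hk h). lra.
    + assert (I := ellF_increment k psi phi Hk ltac:(lra)). lra.
Qed.

Lemma ellF_am (k u : R) : 0 < k < 1 -> ellF k (am k u) = u.
Proof.
  intros Hk. unfold am.
  apply (iota_correct (fun phi : R => ellF k phi = u)).
  now apply ellF_bijective.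
Qed.

Lemma Cheb_cos (s : nat) (theta : R) :
  Cheb s (cos theta) = cos (INR s * theta).
Proof.
  enough (Cheb s (cos theta) = cos (INR s * theta) /\
          Cheb (S s) (cos theta) = cos (INR (S s) * theta)) by tauto.
  induction s as [|s [IH0 IH1]].
  - split; simpl; [now rewrite Rmult_0_l, cos_0 | now rewrite Rmult_1_l].
  - split; [exact IH1|].
    change (Cheb (S (S s)) (cos theta))
      with (2 * cos theta * Cheb (S s) (cos theta) - Cheb s (cos theta)).
    rewrite IH0, IH1, !S_INR.
    replace ((INR s + 1 + 1) * theta) with ((INR s + 1) * theta + theta) by ring.
    replace (INR s * theta) with ((INR s + 1) * theta - theta) by ring.
    rewrite cos_plus, cos_minus. ring.
Qed.

Lemma P_recurrence (k w : R) (n : nat) (x : R) :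
  P k w (S n) x + coef_b k w n * P k w n x
  + coef_u k w n * match n with O => 0 | S l => P k w l x end
  = x * P k w n x.
Proof. simpl. ring. Qed.

Lemma P_monic (k w : R) (n : nat) :
  exists a : nat -> R, a n = 1 /\ (forall i, (n < i)%nat -> a i = 0) /\
    forall x, P k w n x = sum_n (fun i => a i * x ^ i) n.
Proof.
  set (good := fun n (f : R -> R) (a : nat -> R) =>
    a n = 1 /\ (forall i, (n < i)%nat -> a i = 0) /\
    forall x, f x = sum_n (fun i => a i * x ^ i) n).
  set (shift := fun (a : nat -> R) i => match i with O => 0 | S j => a j end).
  assert (Hshift : forall a x n,
    sum_n (fun i => shift a i * x ^ i) (S n) = x * sum_n (fun i => a i * x ^ i) n).
  { intros a x N. induction N as [|N IH].
    - rewrite sum_Sn, !sum_O. unfold plus; simpl. ring.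
    - rewrite sum_Sn, IH, (sum_Sn _ N). unfold plus; simpl. ring. }
  assert (Hext : forall a x n, a (S n) = 0 ->
    sum_n (fun i => a i * x ^ i) (S n) = sum_n (fun i => a i * x ^ i) n).
  { intros a x N Ha. rewrite sum_Sn, Ha. unfold plus; simpl. ring. }
  assert (Hlin : forall (a b c : nat -> R) r s x n,
    sum_n (fun i => (a i - r * b i - s * c i) * x ^ i) n
    = sum_n (fun i => a i * x ^ i) n - r * sum_n (fun i => b i * x ^ i) n
      - s * sum_n (fun i => c i * x ^ i) n).
  { intros a b c r s x N. induction N as [|N IH].
    - rewrite !sum_O. simpl. ring.
    - rewrite !sum_Sn, IH. unfold plus; simpl. ring. }
  enough (Hn : (exists a, good n (P k w n) a) /\
               (exists a, good (S n) (P k w (S n)) a)) by exact (proj1 Hn).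
  induction n as [|n [[a Ha] [b Hb]]].
  - split.
    + exists (fun i => match i with O => 1 | _ => 0 end). repeat split.
      * intros [|i] Hi; [lia | reflexivity].
      * intros x. rewrite sum_O. simpl. ring.
    + exists (fun i => match i with O => - coef_b k w 0 | 1%nat => 1 | _ => 0 end).
      repeat split.
      * intros [|[|i]] Hi; [lia | lia | reflexivity].
      * intros x. rewrite sum_Sn, sum_O. unfold plus; simpl. ring.
  - split; [now exists b|].
    destruct Ha as [_ [Ha0 HaP]]. destruct Hb as [Hb1 [Hb0 HbP]].
    exists (fun i => shift b i - coef_b k w (S n) * b i - coef_u k w (S n) * a i).
    repeat split.
    + simpl. rewrite Hb1, (Hb0 (S (S n))), (Ha0 (S (S n))) by lia. ring.
    + intros [|i] Hi; [lia|]. simpl.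
      rewrite (Hb0 i), (Hb0 (S i)), (Ha0 (S i)) by lia. ring.
    + intros x. rewrite Hlin, Hshift.
      rewrite (Hext b x (S n)) by (apply Hb0; lia).
      rewrite (Hext a x (S n)), (Hext a x n) by (apply Ha0; lia).
      rewrite <- HbP, <- HaP. simpl. ring.
Qed.

(* Main.v *)
Require Import Defs.
From Stdlib Require Import Reals QArith Qreals ZArith Lra Lia.
From Coquelicot Require Import Coquelicot.
Open Scope R_scope.

(** The polynomials come from the unit circle. Let Phi_n be the monic polynomials
    in z generated by Szego's recurrence
    Phi_{n+1}(z) = z Phi_n(z) - a_n z^n Phi_n(1/z) with the real Verblunsky
    coefficients a_n = cn(w(n+1)) for n even and a_n = - dn(w(n+1)) for n odd. For
    z = exp(i theta), Geronimus' relations turn this into a three-term recurrence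
    in x = cos(theta) for z^{-n} Phi_{2n}(z) + z^n Phi_{2n}(1/z), and its
    coefficients are exactly b_n and u_n ([P_szego]). The advantage is that an
    identity between elliptic functions of wn, ws and w splits into steps that
    involve two variables only, and each of these is an addition theorem.

    Explicit expression. The coefficient of z^{n-j} in Phi_n is (-1)^j E_j^n times
    dn(wj) or cn(wj), according to the parity of n ([szego_explicit]): Szego's
    recurrence for these coefficients reduces to
    sn(x+y) cn(y) = sn(x) dn(y) + cn(x+y) sn(y) dn(x) and its twin with cn and dn
    exchanged ([dn_or_cn_add]). This gives the formula for -1 <= x <= 1, and
    both sides are polynomials ([P_explicit]).

    Orthogonality. Integrating cos(t theta) against the discrete measure gives
    cn(wt) for every real t ([cn_bilateral]); hence Szego's recurrence also computes
    the real part of the integral of z^tau Phi_n, which is a constant times cn or dn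
    of w(tau+n) times the product of sn(w(tau+i)) over 0 <= i < n
    ([szego_moment_product]). The zeros tau = 0, -1, ..., 1-n of this product are the
    orthogonality of Phi_n to lower powers, hence of P_n to T_j for j < n
    ([P_cos_moment]); the value of the norm then follows from the three-term
    recurrence ([P_norm]).

    Moments. That the integral of cos(t theta) is cn(wt) is the Fourier expansion
    of cn. Its coefficients come from continuing cn to complex arguments u + iv: the
    integral of cn(u + iv) exp(- i nu u) over a period depends on v through an
    exponential only, and for v tending to K' the pole of cn contributes its residue
    ([cn_fourier_integral]). The series converges to cn at every point by Chernoff's
    argument, in which the partial sums telescope and Bessel's inequality removes
    what remains ([cn_fourier_series]).

    Density. As w/K is irrational, the group generated by w/K and 2 contains
    arbitrarily small positive numbers ([lattice_small]), so the angles of the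
    spectral points are dense modulo 2 pi. *)

(** Views an equation between reals stated in a derived structure of [R] as an
    equation in [R], where [ring] and [field] apply. *)
Ltac as_real := match goal with |- ?a = ?b => change (@eq R a b) end.

(** * The amplitude and the three elliptic functions on the real line *)

Lemma is_derive_eq (f : R -> R) (x l l' : R) :
  is_derive f x l -> l = l' -> is_derive f x l'.
Proof. now intros H <-. Qed.

Lemma ellF_lt_reg (k a b : R) : 0 < k < 1 -> ellF k a < ellF k b -> a < b.
Proof.
  intros Hk H. destruct (Rlt_le_dec a b) as [h|h]; [exact h|].
  pose proof (ellF_increment k b a Hk h). lra.
Qed.

Lemma am_ellF (k phi : R) : 0 < k < 1 -> am k (ellF k phi) = phi.
Proof.
  intros Hk.
  destruct (ellF_bijective k (ellF k phi) Hk) as [p [_ Hp]].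
  transitivity p.
  - symmetry. apply Hp. now apply ellF_am.
  - now apply Hp.
Qed.

Lemma am_lipschitz (k u v : R) : 0 < k < 1 -> Rabs (am k v - am k u) <= Rabs (v - u).
Proof.
  intros Hk.
  pose proof (ellF_am k u Hk) as Hu. pose proof (ellF_am k v Hk) as Hv.
  destruct (Rle_dec (am k u) (am k v)) as [h|h].
  - pose proof (ellF_increment k _ _ Hk h). rewrite Hu, Hv in H.
    rewrite !Rabs_right by lra. lra.
  - assert (h' : am k v <= am k u) by lra.
    pose proof (ellF_increment k _ _ Hk h'). rewrite Hu, Hv in H.
    rewrite !Rabs_left1 by lra. lra.
Qed.

Lemma am_continuous (k u : R) : 0 < k < 1 -> continuous (am k) u.
Proof.
  intros Hk. apply filterlim_locally. intros eps. exists eps. intros v Hv.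
  change (Rabs (am k v - am k u) < eps). change (Rabs (v - u) < eps) in Hv.
  pose proof (am_lipschitz k u v Hk). lra.
Qed.

(** The integrand of [ellF] is the reciprocal of [dn], so this is the derivative of
    an inverse function; the mean value theorem for [ellF] reduces it to the
    continuity of [am]. *)
Lemma am_derive (k u : R) : 0 < k < 1 -> is_derive (am k) u (dn k u).
Proof.
  intros Hk. apply is_derive_Reals. intros eps Heps.
  set (g := fun t => sqrt (1 - k ^ 2 * sin t ^ 2)).
  assert (Cg : continuous (fun v => g v) (am k u)).
  { apply (ex_derive_continuous (fun v => g v)). unfold g. auto_derive.
    destruct (ellF_radicand k (am k u) Hk). repeat split; simpl in *; lra. }
  destruct (proj1 (filterlim_locally _ _) Cg (mkposreal eps Heps)) as [d Hd].
  exists d. intros h Hh0 Hh.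
  destruct (MVT_gen (ellF k) (am k u) (am k (u + h))
              (fun t => / sqrt (1 - k ^ 2 * sin t ^ 2))) as [c [Hc E]].
  - intros x _. now apply ellF_derive.
  - intros x _. apply derivable_continuous_pt.
    exists (/ sqrt (1 - k ^ 2 * sin x ^ 2)).
    now apply is_derive_Reals, ellF_derive.
  - rewrite !ellF_am in E by exact Hk.
    assert (Hg : 0 < g c) by (apply sqrt_lt_R0, ellF_radicand, Hk).
    fold (g c) in E.
    assert (E2 : am k (u + h) - am k u = g c * h).
    { replace h with (u + h - u) at 2 by ring. rewrite E. field. lra. }
    rewrite E2. replace (g c * h / h) with (g c) by (field; exact Hh0).
    change (Rabs (g c - g (am k u)) < eps). apply Hd.
    change (Rabs (c - am k u) < d).
    pose proof (am_lipschitz k u (u + h) Hk) as HL.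
    replace (u + h - u) with h in HL by ring.
    apply Rle_lt_trans with (Rabs (am k (u + h) - am k u)); [|lra].
    unfold Rmin, Rmax in Hc. revert Hc.
    destruct (Rle_dec (am k u) (am k (u + h))); intros Hc;
      unfold Rabs; repeat destruct Rcase_abs; lra.
Qed.

Lemma dn_pos (k u : R) : 0 < k < 1 -> 0 < dn k u.
Proof. intros Hk. apply sqrt_lt_R0. now apply ellF_radicand. Qed.

Lemma cn2 (k u : R) : cn k u ^ 2 = 1 - sn k u ^ 2.
Proof. unfold cn, sn. pose proof (sin2_cos2 (am k u)). unfold Rsqr in H. lra. Qed.

Lemma dn2 (k u : R) : 0 < k < 1 -> dn k u ^ 2 = 1 - k ^ 2 * sn k u ^ 2.
Proof.
  intros Hk. unfold dn. apply pow2_sqrt. destruct (ellF_radicand k (am k u) Hk).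
  unfold sn. lra.
Qed.

Lemma sn_derive (k u : R) : 0 < k < 1 -> is_derive (sn k) u (cn k u * dn k u).
Proof.
  intros Hk. unfold sn, cn.
  replace (cos (am k u) * dn k u) with (dn k u * cos (am k u)) by ring.
  apply (is_derive_comp sin (am k)); [apply is_derive_sin | now apply am_derive].
Qed.

Lemma cn_derive (k u : R) : 0 < k < 1 -> is_derive (cn k) u (- (sn k u * dn k u)).
Proof.
  intros Hk. unfold sn, cn.
  replace (- (sin (am k u) * dn k u)) with (dn k u * - sin (am k u)) by ring.
  apply (is_derive_comp cos (am k)); [apply is_derive_cos | now apply am_derive].
Qed.

Lemma dn_derive (k u : R) :
  0 < k < 1 -> is_derive (dn k) u (- (k ^ 2 * sn k u * cn k u)).
Proof.
  intros Hk. unfold dn at 1.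
  pose proof (dn_pos k u Hk) as Hd. unfold dn in Hd.
  assert (H1 : is_derive (fun v => 1 - k ^ 2 * v ^ 2) (sn k u) (- (2 * k ^ 2 * sn k u))).
  { auto_derive; [exact I | ring]. }
  pose proof (is_derive_comp (fun v => 1 - k ^ 2 * v ^ 2) (sn k) u _ _ H1 (sn_derive k u Hk)) as H2.
  assert (H0 : 0 < 1 - k ^ 2 * sn k u ^ 2) by (apply ellF_radicand; exact Hk).
  pose proof (is_derive_sqrt _ u _ H2 H0) as H3.
  refine (is_derive_eq _ _ _ _ H3 _).
  change (cn k u * dn k u * - (2 * k ^ 2 * sn k u) / (2 * dn k u)
          = - (k ^ 2 * sn k u * cn k u)).
  field. apply Rgt_not_eq. exact Hd.
Qed.

Lemma ellF_0 (k : R) : ellF k 0 = 0.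
Proof. apply (RInt_point (V := R_CompleteNormedModule)). Qed.

Lemma am_0 (k : R) : 0 < k < 1 -> am k 0 = 0.
Proof. intros Hk. pose proof (am_ellF k 0 Hk) as H. now rewrite ellF_0 in H. Qed.

Lemma sn_0 (k : R) : 0 < k < 1 -> sn k 0 = 0.
Proof. intros Hk. unfold sn. rewrite am_0 by exact Hk. apply sin_0. Qed.

Lemma cn_0 (k : R) : 0 < k < 1 -> cn k 0 = 1.
Proof. intros Hk. unfold cn. rewrite am_0 by exact Hk. apply cos_0. Qed.

Lemma dn_0 (k : R) : 0 < k < 1 -> dn k 0 = 1.
Proof.
  intros Hk. unfold dn. rewrite sn_0 by exact Hk. rewrite <- sqrt_1 at 2. f_equal. ring.
Qed.

Lemma const_of_derive0 (f : R -> R) (x y : R) :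
  (forall t, is_derive f t 0) -> f x = f y.
Proof.
  intros H. destruct (MVT_gen f y x (fun _ => 0)) as [c [_ E]].
  - intros t _. apply H.
  - intros t _. apply derivable_continuous_pt. exists 0. apply is_derive_Reals, H.
  - lra.
Qed.

Lemma ellF_opp (k phi : R) : 0 < k < 1 -> ellF k (- phi) = - ellF k phi.
Proof.
  intros Hk.
  enough (ellF k (- phi) + ellF k phi = 0) by lra.
  replace 0 with (ellF k (- 0) + ellF k 0) by (rewrite Ropp_0, ellF_0; ring).
  apply (const_of_derive0 (fun t => ellF k (- t) + ellF k t)). intros t.
  replace 0 with ((-1) * / sqrt (1 - k ^ 2 * sin (- t) ^ 2) + / sqrt (1 - k ^ 2 * sin t ^ 2)).
  2:{ rewrite sin_neg. replace ((- sin t) ^ 2) with (sin t ^ 2) by ring. ring. }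
  apply (is_derive_plus (fun t => ellF k (- t)) (ellF k)); [|now apply ellF_derive].
  apply (is_derive_comp (ellF k) (fun t => - t) t _ (-1) (ellF_derive k (- t) Hk)).
  auto_derive; [exact I | ring].
Qed.

(** The integrand has period pi, so the increment over a period is a constant;
    oddness evaluates it at phi = - pi/2. *)
Lemma ellF_shift (k phi : R) : 0 < k < 1 -> ellF k (phi + PI) = ellF k phi + 2 * ellK k.
Proof.
  intros Hk.
  assert (C : forall x y, ellF k (x + PI) - ellF k x = ellF k (y + PI) - ellF k y).
  { intros x y. apply (const_of_derive0 (fun t => ellF k (t + PI) - ellF k t)). intros t.
    replace 0 with (/ sqrt (1 - k ^ 2 * sin (t + PI) ^ 2) * 1 - / sqrt (1 - k ^ 2 * sin t ^ 2)).
    2:{ rewrite neg_sin. replace ((- sin t) ^ 2) with (sin t ^ 2) by ring. ring. }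
    apply (is_derive_minus (fun t => ellF k (t + PI)) (ellF k)); [|now apply ellF_derive].
    pose proof (is_derive_comp (ellF k) (fun t => t + PI) t _ 1 (ellF_derive k (t + PI) Hk)) as H.
    rewrite Rmult_comm. apply H. auto_derive; [exact I | ring]. }
  pose proof (C phi (- (PI / 2))) as E.
  replace (- (PI / 2) + PI) with (PI / 2) in E by field.
  pose proof (ellF_opp k (PI / 2) Hk). unfold ellK. lra.
Qed.

Lemma am_shift (k u : R) : 0 < k < 1 -> am k (u + 2 * ellK k) = am k u + PI.
Proof.
  intros Hk. rewrite <- (ellF_am k u Hk) at 1. rewrite <- ellF_shift by exact Hk.
  now apply am_ellF.
Qed.

Lemma am_opp (k u : R) : 0 < k < 1 -> am k (- u) = - am k u.
Proof.
  intros Hk. rewrite <- (ellF_am k u Hk) at 1. rewrite <- ellF_opp by exact Hk.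
  now apply am_ellF.
Qed.

Lemma cn_shift (k u : R) : 0 < k < 1 -> cn k (u + 2 * ellK k) = - cn k u.
Proof. intros Hk. unfold cn. rewrite am_shift by exact Hk. apply neg_cos. Qed.

Lemma sn_opp (k u : R) : 0 < k < 1 -> sn k (- u) = - sn k u.
Proof. intros Hk. unfold sn. rewrite am_opp by exact Hk. apply sin_neg. Qed.

Lemma cn_opp (k u : R) : 0 < k < 1 -> cn k (- u) = cn k u.
Proof. intros Hk. unfold cn. rewrite am_opp by exact Hk. apply cos_neg. Qed.

Lemma dn_opp (k u : R) : 0 < k < 1 -> dn k (- u) = dn k u.
Proof.
  intros Hk. unfold dn. rewrite sn_opp by exact Hk. do 3 f_equal. ring.
Qed.

Lemma ellK_pos (k : R) : 0 < k < 1 -> 0 < ellK k.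
Proof.
  intros Hk. pose proof PI_RGT_0.
  pose proof (ellF_increment k 0 (PI / 2) Hk ltac:(lra)).
  rewrite ellF_0 in H0. unfold ellK. lra.
Qed.

Lemma am_K (k : R) : 0 < k < 1 -> am k (ellK k) = PI / 2.
Proof. intros Hk. now apply am_ellF. Qed.

Lemma am_between (k u : R) : 0 < k < 1 -> 0 < u < ellK k -> 0 < am k u < PI / 2.
Proof.
  intros Hk [H1 H2]. split; apply (ellF_lt_reg k); try exact Hk;
    rewrite ellF_am by exact Hk.
  - now rewrite ellF_0.
  - exact H2.
Qed.

Lemma sn_zero (k u : R) :
  0 < k < 1 -> sn k u = 0 -> exists m : Z, u = 2 * ellK k * IZR m.
Proof.
  intros Hk H. destruct (sin_eq_0_0 _ H) as [m Hm]. exists m.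
  rewrite <- (ellF_am k u Hk), Hm. clear u H Hm.
  assert (P : forall n : nat, ellF k (INR n * PI) = 2 * ellK k * INR n).
  { induction n as [|n IH]; [simpl; rewrite Rmult_0_l, ellF_0; ring|].
    rewrite S_INR. replace ((INR n + 1) * PI) with (INR n * PI + PI) by ring.
    rewrite ellF_shift, IH by exact Hk. ring. }
  destruct (Z_le_gt_dec 0 m) as [h|h].
  - rewrite <- (Z2Nat.id m h), <- INR_IZR_INZ. apply P.
  - replace m with (- Z.of_nat (Z.to_nat (- m)))%Z by lia.
    rewrite opp_IZR, <- INR_IZR_INZ, Ropp_mult_distr_l_reverse, ellF_opp, P by exact Hk. ring.
Qed.

Lemma sn_denominator_pos (k u v : R) : 0 < k < 1 -> 0 < 1 - k ^ 2 * sn k u ^ 2 * sn k v ^ 2.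
Proof.
  intros Hk. pose proof (ellF_radicand k (am k u) Hk). fold (sn k u) in H.
  assert (0 <= sn k v ^ 2 <= 1).
  { pose proof (cn2 k v). pose proof (pow2_ge_0 (cn k v)). pose proof (pow2_ge_0 (sn k v)). lra. }
  assert (0 <= k ^ 2 * sn k u ^ 2).
  { apply Rmult_le_pos; apply pow2_ge_0. }
  nra.
Qed.

(** * Addition theorems *)

Lemma jacobi_ex_derive (k u : R) :
  0 < k < 1 -> ex_derive (sn k) u /\ ex_derive (cn k) u /\ ex_derive (dn k) u.
Proof.
  intros Hk. repeat split; eexists;
    [now apply sn_derive | now apply cn_derive | now apply dn_derive].
Qed.

Lemma sn_Derive (k u : R) : 0 < k < 1 -> Derive (fun t => sn k t) u = cn k u * dn k u.
Proof. intros Hk. now apply is_derive_unique, sn_derive. Qed.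

Lemma cn_Derive (k u : R) : 0 < k < 1 -> Derive (fun t => cn k t) u = - (sn k u * dn k u).
Proof. intros Hk. now apply is_derive_unique, cn_derive. Qed.

Lemma dn_Derive (k u : R) :
  0 < k < 1 -> Derive (fun t => dn k t) u = - (k ^ 2 * sn k u * cn k u).
Proof. intros Hk. now apply is_derive_unique, dn_derive. Qed.

Ltac jacobi_relations k u Hk Ec Ed :=
  let s := fresh "s" in let c := fresh "c" in let d := fresh "d" in
  pose proof (cn2 k u) as Ec; pose proof (dn2 k u Hk) as Ed;
  set (s := sn k u) in *; set (c := cn k u) in *; set (d := dn k u) in *;
  clearbody s c d.

(** Euler's method for addition theorems: an expression in the functions at t and at
    z - t that is constant in t takes at t = x its value at t = 0. *)
Lemma addition_constant (k z : R) (f : R -> R -> R -> R -> R -> R -> R) :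
  0 < k < 1 ->
  (forall t, is_derive (fun t => f (sn k t) (cn k t) (dn k t)
                 (sn k (z - t)) (cn k (z - t)) (dn k (z - t))) t 0) ->
  forall x, f (sn k x) (cn k x) (dn k x) (sn k (z - x)) (cn k (z - x)) (dn k (z - x))
            = f 0 1 1 (sn k z) (cn k z) (dn k z).
Proof.
  intros Hk H x.
  rewrite (const_of_derive0 _ x 0 H), sn_0, cn_0, dn_0, Rminus_0_r by exact Hk.
  reflexivity.
Qed.

(** Proves that a rational expression in the functions at t and z - t has zero
    derivative: its numerator vanishes modulo the relations between the squares. *)
Ltac addition_derivative k z Hk :=
  let Ec := fresh "Ec" in let Ed := fresh "Ed" in
  let Ec' := fresh "Ec" in let Ed' := fresh "Ed" in
  let t := fresh "t" in let N := fresh "N" in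
  intros t; pose proof (sn_denominator_pos k t (z + - t) Hk) as N;
  auto_derive;
  [ destruct (jacobi_ex_derive k t Hk) as [? [? ?]];
    destruct (jacobi_ex_derive k (z + - t) Hk) as [? [? ?]];
    repeat split; try assumption; intros ?; lra
  | rewrite ?sn_Derive, ?cn_Derive, ?dn_Derive by exact Hk;
    jacobi_relations k t Hk Ec Ed; jacobi_relations k (z + - t) Hk Ec' Ed';
    field_simplify_eq; [ring [Ec Ed Ec' Ed'] | lra] ].

Lemma sn_add (k x y : R) : 0 < k < 1 ->
  sn k (x + y) = (sn k x * cn k y * dn k y + sn k y * cn k x * dn k x)
                 / (1 - k ^ 2 * sn k x ^ 2 * sn k y ^ 2).
Proof.
  intros Hk. set (z := x + y). replace y with (z - x) by (unfold z; ring).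
  rewrite (addition_constant k z (fun s c d s' c' d' =>
    (s * c' * d' + s' * c * d) / (1 - k ^ 2 * s ^ 2 * s' ^ 2)) Hk); [field|].
  addition_derivative k z Hk.
Qed.

Lemma cn_add (k x y : R) : 0 < k < 1 ->
  cn k (x + y) = (cn k x * cn k y - sn k x * sn k y * dn k x * dn k y)
                 / (1 - k ^ 2 * sn k x ^ 2 * sn k y ^ 2).
Proof.
  intros Hk. set (z := x + y). replace y with (z - x) by (unfold z; ring).
  rewrite (addition_constant k z (fun s c d s' c' d' =>
    (c * c' - s * s' * d * d') / (1 - k ^ 2 * s ^ 2 * s' ^ 2)) Hk); [field|].
  addition_derivative k z Hk.
Qed.

Lemma dn_add (k x y : R) : 0 < k < 1 ->
  dn k (x + y) = (dn k x * dn k y - k ^ 2 * sn k x * sn k y * cn k x * cn k y)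
                 / (1 - k ^ 2 * sn k x ^ 2 * sn k y ^ 2).
Proof.
  intros Hk. set (z := x + y). replace y with (z - x) by (unfold z; ring).
  rewrite (addition_constant k z (fun s c d s' c' d' =>
    (d * d' - k ^ 2 * s * s' * c * c') / (1 - k ^ 2 * s ^ 2 * s' ^ 2)) Hk); [field|].
  addition_derivative k z Hk.
Qed.

Ltac addition_field k x y Hk :=
  let Ec := fresh "Ec" in let Ed := fresh "Ed" in
  let Ec' := fresh "Ec" in let Ed' := fresh "Ed" in
  pose proof (sn_denominator_pos k x y Hk);
  jacobi_relations k x Hk Ec Ed; jacobi_relations k y Hk Ec' Ed';
  field_simplify_eq; [ring [Ec Ed Ec' Ed'] | lra].

(** The two mixed forms of the addition theorem, here and in [dn_add_cn], have no
    denominator; they drive the product formula for the moments. *)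
Lemma cn_add_dn (k x y : R) : 0 < k < 1 ->
  cn k (x + y) = cn k x * cn k y - sn k x * sn k y * dn k (x + y).
Proof.
  intros Hk. rewrite cn_add, dn_add by exact Hk. addition_field k x y Hk.
Qed.

Lemma dn_add_cn (k x y : R) : 0 < k < 1 ->
  dn k (x + y) = dn k x * dn k y - k ^ 2 * sn k x * sn k y * cn k (x + y).
Proof.
  intros Hk. rewrite cn_add, dn_add by exact Hk. addition_field k x y Hk.
Qed.

(** Together with [sn_add_mul_dn], what one step of Szego's recurrence asks of the
    explicit coefficients. *)
Lemma sn_add_mul_cn (k x y : R) : 0 < k < 1 ->
  sn k (x + y) * cn k y = sn k x * dn k y + cn k (x + y) * sn k y * dn k x.
Proof.
  intros Hk. rewrite sn_add, cn_add by exact Hk. addition_field k x y Hk.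
Qed.

Lemma sn_add_mul_dn (k x y : R) : 0 < k < 1 ->
  sn k (x + y) * dn k y = sn k x * cn k y + dn k (x + y) * sn k y * cn k x.
Proof.
  intros Hk. rewrite sn_add, dn_add by exact Hk. addition_field k x y Hk.
Qed.

(** * cn on the period strip, in real form *)

Definition comod (k : R) : R := sqrt (1 - k ^ 2).

Lemma comod_sq (k : R) : 0 < k < 1 -> comod k ^ 2 = 1 - k ^ 2.
Proof. intros Hk. unfold comod. apply pow2_sqrt. nra. Qed.

Lemma comod_bounds (k : R) : 0 < k < 1 -> 0 < comod k < 1.
Proof.
  intros Hk. unfold comod. split.
  - apply sqrt_lt_R0. nra.
  - rewrite <- sqrt_1 at 2. apply sqrt_lt_1_alt. nra.
Qed.

(** Denominator of cn(u + iv) in Jacobi's imaginary transformation, where the real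
    part u enters with the modulus k and the imaginary part v with the complementary
    modulus. *)
Definition strip_den (k u v : R) : R :=
  cn (comod k) v ^ 2 + k ^ 2 * sn k u ^ 2 * sn (comod k) v ^ 2.

(** With [im_cn], the decomposition cn(u + iv) = re_cn - i im_cn into real
    functions; the two Cauchy-Riemann equations carry all that is used of
    analyticity. *)
Definition re_cn (k u v : R) : R := cn k u * cn (comod k) v / strip_den k u v.

Definition im_cn (k u v : R) : R :=
  sn k u * dn k u * (sn (comod k) v * dn (comod k) v) / strip_den k u v.

(** Common value of the v-derivative of [re_cn] and the u-derivative of [im_cn]. *)
Definition dre_cn (k u v : R) : R :=
  cn k u * sn (comod k) v * dn (comod k) v
  * (2 * dn k u ^ 2 - 1 - dn k u ^ 2 * sn (comod k) v ^ 2) / strip_den k u v ^ 2.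

(** Common value of the v-derivative of [im_cn] and minus the u-derivative of
    [re_cn]. *)
Definition dim_cn (k u v : R) : R :=
  cn (comod k) v * sn k u * dn k u
  * (strip_den k u v + 2 * k ^ 2 * cn k u ^ 2 * sn (comod k) v ^ 2) / strip_den k u v ^ 2.

Lemma strip_den_pos (k u v : R) : cn (comod k) v <> 0 -> 0 < strip_den k u v.
Proof.
  intros H. unfold strip_den. pose proof (pow2_gt_0 _ H).
  assert (0 <= k ^ 2 * sn k u ^ 2 * sn (comod k) v ^ 2).
  { replace (k ^ 2 * sn k u ^ 2 * sn (comod k) v ^ 2)
      with ((k * sn k u * sn (comod k) v) ^ 2) by ring. apply pow2_ge_0. }
  lra.
Qed.

Ltac strip_derivative k u v Hk HD :=
  let Hk' := fresh "Hk'" in pose proof (comod_bounds k Hk) as Hk';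
  let E := fresh "E" in pose proof (comod_sq k Hk) as E;
  let E1 := fresh "E1" in let E2 := fresh "E2" in
  let E3 := fresh "E3" in let E4 := fresh "E4" in
  unfold strip_den in *;
  eapply is_derive_eq;
  [ auto_derive; [|reflexivity];
    destruct (jacobi_ex_derive k u Hk) as [? [? ?]];
    destruct (jacobi_ex_derive (comod k) v Hk') as [? [? ?]];
    repeat split; try assumption; intros ?; apply HD; simpl; lra
  | rewrite ?sn_Derive, ?cn_Derive, ?dn_Derive by assumption;
    jacobi_relations k u Hk E1 E2; jacobi_relations (comod k) v Hk' E3 E4;
    set (k' := comod k) in *; clearbody k';
    field_simplify_eq; [ring [E E1 E2 E3 E4] |]; let h := fresh "h" in
    intros h; apply HD; rewrite <- h; ring ].

Lemma re_cn_derive_v (k u v : R) :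
  0 < k < 1 -> strip_den k u v <> 0 ->
  is_derive (fun v => re_cn k u v) v (dre_cn k u v).
Proof. intros Hk HD. unfold re_cn, dre_cn. strip_derivative k u v Hk HD. Qed.

Lemma im_cn_derive_u (k u v : R) :
  0 < k < 1 -> strip_den k u v <> 0 ->
  is_derive (fun u => im_cn k u v) u (dre_cn k u v).
Proof. intros Hk HD. unfold im_cn, dre_cn. strip_derivative k u v Hk HD. Qed.

Lemma im_cn_derive_v (k u v : R) :
  0 < k < 1 -> strip_den k u v <> 0 ->
  is_derive (fun v => im_cn k u v) v (dim_cn k u v).
Proof. intros Hk HD. unfold im_cn, dim_cn. strip_derivative k u v Hk HD. Qed.

Lemma re_cn_derive_u (k u v : R) :
  0 < k < 1 -> strip_den k u v <> 0 ->
  is_derive (fun u => re_cn k u v) u (- dim_cn k u v).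
Proof. intros Hk HD. unfold re_cn, dim_cn. strip_derivative k u v Hk HD. Qed.

(** * Fourier integrals along horizontal lines of the strip *)

Lemma jacobi_continuity_pt (k u : R) : 0 < k < 1 ->
  continuity_pt (sn k) u /\ continuity_pt (cn k) u /\ continuity_pt (dn k) u.
Proof.
  intros Hk. destruct (jacobi_ex_derive k u Hk) as [H1 [H2 H3]].
  repeat split; apply continuity_pt_filterlim; now apply (ex_derive_continuous (V := R_NormedModule)).
Qed.

Ltac cont2d k Hk :=
  repeat first
    [ apply continuity_2d_pt_const
    | apply continuity_2d_pt_id1
    | apply continuity_2d_pt_id2
    | apply continuity_2d_pt_minus
    | apply continuity_2d_pt_plus
    | apply continuity_2d_pt_mult
    | apply (continuity_1d_2d_pt_comp (sn _)); [apply jacobi_continuity_pt; assumption|]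
    | apply (continuity_1d_2d_pt_comp (cn _)); [apply jacobi_continuity_pt; assumption|]
    | apply (continuity_1d_2d_pt_comp (dn _)); [apply jacobi_continuity_pt; assumption|]
    | apply (continuity_1d_2d_pt_comp cos); [apply continuity_cos|]
    | apply (continuity_1d_2d_pt_comp sin); [apply continuity_sin|]
    | apply (continuity_1d_2d_pt_comp (fun t => t ^ 2));
        [apply derivable_continuous_pt, derivable_pt_pow|] ].

Lemma strip_den_continuity (k u v : R) : 0 < k < 1 ->
  continuity_2d_pt (fun v u => strip_den k u v) v u.
Proof.
  intros Hk. pose proof (comod_bounds k Hk). unfold strip_den. cont2d k Hk.
Qed.

Lemma dre_cn_continuity (k u v : R) : 0 < k < 1 -> strip_den k u v <> 0 ->
  continuity_2d_pt (fun v u => dre_cn k u v) v u.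
Proof.
  intros Hk HD. pose proof (comod_bounds k Hk). unfold dre_cn, Rdiv.
  apply continuity_2d_pt_mult; [cont2d k Hk|].
  apply (continuity_2d_pt_inv (fun v u => strip_den k u v ^ 2)).
  - apply (continuity_1d_2d_pt_comp (fun t => t ^ 2));
        [apply derivable_continuous_pt, derivable_pt_pow|now apply strip_den_continuity].
  - now apply pow_nonzero.
Qed.

Lemma dim_cn_continuity (k u v : R) : 0 < k < 1 -> strip_den k u v <> 0 ->
  continuity_2d_pt (fun v u => dim_cn k u v) v u.
Proof.
  intros Hk HD. pose proof (comod_bounds k Hk). unfold dim_cn, Rdiv.
  apply continuity_2d_pt_mult.
  { apply continuity_2d_pt_mult; [cont2d k Hk|].
    apply continuity_2d_pt_plus; [now apply strip_den_continuity | cont2d k Hk]. }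
  apply (continuity_2d_pt_inv (fun v u => strip_den k u v ^ 2)).
  - apply (continuity_1d_2d_pt_comp (fun t => t ^ 2));
        [apply derivable_continuous_pt, derivable_pt_pow|now apply strip_den_continuity].
  - now apply pow_nonzero.
Qed.

Lemma continuity_2d_section (f : R -> R -> R) (x y : R) :
  continuity_2d_pt f x y -> continuous (fun t => f x t) y.
Proof.
  intros H. apply filterlim_locally. intros eps. destruct (H eps) as [d Hd].
  exists d. intros t Ht. apply (Hd x t); [|exact Ht].
  replace (x - x) with 0 by ring. rewrite Rabs_R0. apply cond_pos.
Qed.

(** Differentiation under the integral sign for an integrand f(u,v) g(u). *)
Lemma integral_derive_v (f df : R -> R -> R) (g : R -> R) (b v : R) :
  (locally v (fun v => forall u, is_derive (fun v => f u v) v (df u v))) ->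
  (forall u, continuity_2d_pt (fun v u => df u v) v u) ->
  (locally v (fun v => forall u, continuous (fun u => f u v) u)) ->
  (forall u, continuous g u) ->
  is_derive (fun v => RInt (fun u => f u v * g u) 0 b) v (RInt (fun u => df u v * g u) 0 b).
Proof.
  intros H1 H2 H3 Hg.
  assert (D : forall u, Derive (fun v => f u v * g u) v = df u v * g u).
  { intros u. apply is_derive_unique.
    pose proof (locally_singleton _ _ H1 u) as Hd. cbv beta in Hd.
    apply (is_derive_ext (fun v => g u * f u v)); [intros; apply Rmult_comm|].
    rewrite Rmult_comm. now apply (is_derive_scal (fun v => f u v)). }
  rewrite <- (RInt_ext (fun u => Derive (fun v => f u v * g u) v)) by (intros; apply D).
  apply (is_derive_RInt_param (fun v u => f u v * g u) 0 b v).
  - refine (filter_imp _ _ _ H1). intros y Hy t _.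
    exists (g t * df t y).
    apply (is_derive_ext (fun v => g t * f t v)); [intros; apply Rmult_comm|].
    now apply (is_derive_scal (fun v => f t v)).
  - intros t _.
    apply (continuity_2d_pt_ext_loc (fun v u => df u v * g u)).
    + destruct H1 as [d Hd]. exists d. intros x y Hx _. symmetry.
      apply is_derive_unique.
      apply (is_derive_ext (fun v => g y * f y v)); [intros; apply Rmult_comm|].
      rewrite Rmult_comm. apply (is_derive_scal (fun v => f y v)). now apply Hd.
    + apply continuity_2d_pt_mult; [apply H2|].
      apply (continuity_1d_2d_pt_comp g); [|apply continuity_2d_pt_id2].
      apply continuity_pt_filterlim, Hg.
  - refine (filter_imp _ _ _ H3). intros y Hy. apply (ex_RInt_continuous (V := R_CompleteNormedModule)).
    intros z _. apply (continuous_mult (fun u => f u y) g); [apply Hy | apply Hg].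
Qed.

(** The denominator vanishes only where cn of v with the complementary modulus does,
    so horizontal lines near this one contain no pole of cn(u + iv). *)
Lemma strip_locally (k v : R) : 0 < k < 1 -> cn (comod k) v <> 0 ->
  locally v (fun v => forall u, strip_den k u v <> 0).
Proof.
  intros Hk Hv. pose proof (comod_bounds k Hk) as Hk'.
  destruct (jacobi_continuity_pt (comod k) v Hk') as [_ [C _]].
  apply continuity_pt_filterlim in C.
  assert (L : locally (cn (comod k) v) (fun y => y <> 0)) by now apply open_neq.
  assert (L' : locally v (fun y => cn (comod k) y <> 0)) by exact (C _ L).
  refine (filter_imp _ _ _ L'). intros y Hy u.
  apply Rgt_not_eq. now apply strip_den_pos.
Qed.

(** For cos(nu K) = 0 the integral over a period of cn(u + iv) exp(- i nu u) is, by
    symmetry, made of this quarter-period integral and of [im_coef]. *)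
Definition re_coef (k nu v : R) : R :=
  RInt (fun u => re_cn k u v * cos (nu * u)) 0 (ellK k).

Definition im_coef (k nu v : R) : R :=
  RInt (fun u => im_cn k u v * sin (nu * u)) 0 (ellK k).

Lemma continuous_of_derive (f : R -> R) (x l : R) : is_derive f x l -> continuous f x.
Proof. intros H. apply (ex_derive_continuous (V := R_NormedModule)). now exists l. Qed.

Lemma is_derive_Rmult (f g : R -> R) (x a b l : R) :
  is_derive f x a -> is_derive g x b -> a * g x + f x * b = l ->
  is_derive (fun t => f t * g t) x l.
Proof.
  intros Hf Hg <-. apply is_derive_Reals.
  apply (derivable_pt_lim_mult f g); now apply is_derive_Reals.
Qed.

Lemma trig_derive (nu u : R) :
  is_derive (fun u => cos (nu * u)) u (- nu * sin (nu * u)) /\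
  is_derive (fun u => sin (nu * u)) u (nu * cos (nu * u)).
Proof. split; (auto_derive; [exact I | ring]). Qed.

Lemma cn_K (k : R) : 0 < k < 1 -> cn k (ellK k) = 0.
Proof. intros Hk. unfold cn. rewrite am_K by exact Hk. apply cos_PI2. Qed.

Lemma sn_K (k : R) : 0 < k < 1 -> sn k (ellK k) = 1.
Proof. intros Hk. unfold sn. rewrite am_K by exact Hk. apply sin_PI2. Qed.

Lemma RInt_by_parts_balance (F p q : R -> R) (b r : R) :
  (forall u, is_derive F u (p u - r * q u)) ->
  (forall u, continuous p u) -> (forall u, continuous q u) ->
  F b = F 0 -> RInt p 0 b = r * RInt q 0 b.
Proof.
  intros HF Hp Hq HE.
  assert (Ip : is_RInt p 0 b (RInt p 0 b)).
  { apply (RInt_correct (V := R_CompleteNormedModule)).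
    apply (ex_RInt_continuous (V := R_CompleteNormedModule)). intros; apply Hp. }
  assert (Iq : is_RInt q 0 b (RInt q 0 b)).
  { apply (RInt_correct (V := R_CompleteNormedModule)).
    apply (ex_RInt_continuous (V := R_CompleteNormedModule)). intros; apply Hq. }
  pose proof (is_RInt_minus _ _ _ _ _ _ Ip (is_RInt_scal _ _ _ r _ Iq)) as I1.
  pose proof (is_RInt_derive (V := R_CompleteNormedModule) F (fun u => p u - r * q u) 0 b) as I2.
  assert (I3 : is_RInt (fun u => p u - r * q u) 0 b (minus (F b) (F 0))).
  { apply I2; [intros; apply HF|]. intros x _.
    apply (continuous_minus p (fun u => r * q u)); [apply Hp|].
    apply (continuous_scal_r r q). apply Hq. }
  apply (is_RInt_unique (V := R_CompleteNormedModule)) in I1.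
  apply (is_RInt_unique (V := R_CompleteNormedModule)) in I3.
  assert (E : minus (RInt p 0 b) (scal r (RInt q 0 b)) = minus (F b) (F 0)).
  { refine (eq_trans (eq_sym I1) _). refine (eq_trans _ I3). reflexivity. }
  rewrite HE in E. unfold minus, plus, opp, scal in E; simpl in E. unfold mult in E; simpl in E.
  lra.
Qed.

(** The Cauchy-Riemann equations and an integration by parts. The boundary terms
    vanish because sn(0) = 0, cn(K) = 0 and cos(nu K) = 0. *)
Lemma strip_coef_derive (k nu v : R) :
  0 < k < 1 -> cn (comod k) v <> 0 -> cos (nu * ellK k) = 0 ->
  is_derive (re_coef k nu) v (nu * im_coef k nu v) /\
  is_derive (im_coef k nu) v (nu * re_coef k nu v).
Proof.
  intros Hk Hv Hnu. pose proof (strip_locally k v Hk Hv) as HL.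
  pose proof (locally_singleton _ _ HL) as H0. cbv beta in H0.
  assert (Cc : forall u, continuous (fun u => cos (nu * u)) u).
  { intros u. exact (continuous_of_derive _ _ _ (proj1 (trig_derive nu u))). }
  assert (Cs : forall u, continuous (fun u => sin (nu * u)) u).
  { intros u. exact (continuous_of_derive _ _ _ (proj2 (trig_derive nu u))). }
  assert (Cre : forall v, (forall u, strip_den k u v <> 0) ->
            forall u, continuous (fun u => re_cn k u v) u).
  { intros y Hy u. exact (continuous_of_derive _ _ _ (re_cn_derive_u k u y Hk (Hy u))). }
  assert (Cim : forall v, (forall u, strip_den k u v <> 0) ->
            forall u, continuous (fun u => im_cn k u v) u).
  { intros y Hy u. exact (continuous_of_derive _ _ _ (im_cn_derive_u k u y Hk (Hy u))). }
  split.
  - unfold re_coef, im_coef.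
    rewrite <- (RInt_by_parts_balance (fun u => im_cn k u v * cos (nu * u))
                 (fun u => dre_cn k u v * cos (nu * u))).
    + apply (integral_derive_v (re_cn k) (dre_cn k) (fun u => cos (nu * u))).
      * refine (filter_imp _ _ _ HL). intros y Hy u. now apply re_cn_derive_v.
      * intros u. now apply dre_cn_continuity.
      * refine (filter_imp _ _ _ HL). intros y Hy u. now apply Cre.
      * exact Cc.
    + intros u.
      refine (is_derive_Rmult _ _ _ _ _ _ (im_cn_derive_u k u v Hk (H0 u))
                (proj1 (trig_derive nu u)) _). ring.
    + intros u. apply (continuous_mult (fun u => dre_cn k u v)); [|apply Cc].
      apply (continuity_2d_section (fun v u => dre_cn k u v)). now apply dre_cn_continuity.
    + intros u. apply (continuous_mult (fun u => im_cn k u v)); [now apply Cim | apply Cs].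
    + rewrite Hnu. unfold im_cn. rewrite sn_0 by exact Hk. unfold Rdiv. ring.
  - unfold re_coef, im_coef.
    rewrite <- (RInt_by_parts_balance (fun u => - (re_cn k u v * sin (nu * u)))
                 (fun u => dim_cn k u v * sin (nu * u))).
    + apply (integral_derive_v (im_cn k) (dim_cn k) (fun u => sin (nu * u))).
      * refine (filter_imp _ _ _ HL). intros y Hy u. now apply im_cn_derive_v.
      * intros u. now apply dim_cn_continuity.
      * refine (filter_imp _ _ _ HL). intros y Hy u. now apply Cim.
      * exact Cs.
    + intros u.
      refine (is_derive_eq _ _ _ _ (is_derive_opp (fun u => re_cn k u v * sin (nu * u)) u _
        (is_derive_Rmult _ _ _ _ _ _ (re_cn_derive_u k u v Hk (H0 u))
                (proj2 (trig_derive nu u)) eq_refl)) _).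
      change opp with Ropp. ring.
    + intros u. apply (continuous_mult (fun u => dim_cn k u v)); [|apply Cs].
      apply (continuity_2d_section (fun v u => dim_cn k u v)). now apply dim_cn_continuity.
    + intros u. apply (continuous_mult (fun u => re_cn k u v)); [now apply Cre | apply Cc].
    + rewrite Rmult_0_r, sin_0. unfold re_cn. rewrite cn_K by exact Hk. unfold Rdiv. ring.
Qed.

(** * Growth of the Fourier integral towards the pole *)

Lemma const_on_interval (f : R -> R) (a b : R) :
  a <= b -> (forall t, a <= t <= b -> is_derive f t 0) -> f b = f a.
Proof.
  intros Hab H.
  destruct (MVT_gen f a b (fun _ => 0)) as [c [_ E]].
  - rewrite Rmin_left, Rmax_right by exact Hab. intros t Ht. apply H. lra.
  - rewrite Rmin_left, Rmax_right by exact Hab. intros t Ht.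
    apply continuity_pt_filterlim. exact (continuous_of_derive _ _ _ (H t Ht)).
  - lra.
Qed.

Lemma jacobi_pos (k u : R) : 0 < k < 1 -> 0 < u < ellK k -> 0 < sn k u /\ 0 < cn k u.
Proof.
  intros Hk Hu. pose proof (am_between k u Hk Hu). split.
  - apply sin_gt_0; lra.
  - apply cos_gt_0; lra.
Qed.

(** The linear system of [strip_coef_derive] makes the sum and the difference of the
    two integrals exponentials, and [im_coef] vanishes at v = 0. *)
Lemma re_coef_cosh (k nu v : R) :
  0 < k < 1 -> cos (nu * ellK k) = 0 -> 0 <= v < ellK (comod k) ->
  2 * re_coef k nu v = re_coef k nu 0 * (exp (nu * v) + exp (- (nu * v))).
Proof.
  intros Hk Hnu Hv. pose proof (comod_bounds k Hk) as Hk'.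
  assert (NZ : forall t, 0 <= t <= v -> cn (comod k) t <> 0).
  { intros t Ht. destruct (Req_dec t 0) as [->|].
    - rewrite cn_0 by exact Hk'. lra.
    - apply Rgt_not_eq. apply jacobi_pos; [exact Hk'|lra]. }
  assert (I0 : im_coef k nu 0 = 0).
  { unfold im_coef.
    rewrite (RInt_ext _ (fun _ => 0)).
    - rewrite (RInt_const (V := R_CompleteNormedModule)). unfold scal; simpl.
      unfold mult; simpl. ring.
    - intros u _. unfold im_cn. rewrite sn_0 by exact Hk'.
      as_real. unfold Rdiv. ring. }
  assert (DE : forall r t : R, is_derive (fun t => exp (r * t)) t (r * exp (r * t))).
  { intros r t. auto_derive; [exact I | ring]. }
  assert (E1 : (re_coef k nu v + im_coef k nu v) * exp (- nu * v) = re_coef k nu 0).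
  { transitivity ((re_coef k nu 0 + im_coef k nu 0) * exp (- nu * 0)).
    - apply (const_on_interval (fun v => (re_coef k nu v + im_coef k nu v) * exp (- nu * v)));
        [lra|].
      intros t Ht. destruct (strip_coef_derive k nu t Hk (NZ t Ht) Hnu) as [D1 D2].
      refine (is_derive_Rmult _ _ _ _ _ _
        (is_derive_plus (re_coef k nu) (im_coef k nu) t _ _ D1 D2) (DE (- nu) t) _).
      change plus with Rplus. ring.
    - rewrite Rmult_0_r, exp_0, I0. ring. }
  assert (E2 : (re_coef k nu v - im_coef k nu v) * exp (nu * v) = re_coef k nu 0).
  { transitivity ((re_coef k nu 0 - im_coef k nu 0) * exp (nu * 0)).
    - apply (const_on_interval (fun v => (re_coef k nu v - im_coef k nu v) * exp (nu * v)));
        [lra|].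
      intros t Ht. destruct (strip_coef_derive k nu t Hk (NZ t Ht) Hnu) as [D1 D2].
      refine (is_derive_Rmult _ _ _ _ _ _
        (is_derive_minus (re_coef k nu) (im_coef k nu) t _ _ D1 D2) (DE nu t) _).
      change minus with Rminus. ring.
    - rewrite Rmult_0_r, exp_0, I0. ring. }
  assert (X : exp (nu * v) * exp (- nu * v) = 1).
  { rewrite <- exp_plus. replace (nu * v + - nu * v) with 0 by ring. apply exp_0. }
  replace (- (nu * v)) with (- nu * v) by ring.
  rewrite Rmult_plus_distr_l. rewrite <- E1 at 1. rewrite <- E2.
  transitivity ((re_coef k nu v + im_coef k nu v) * (exp (nu * v) * exp (- nu * v)) +
    (re_coef k nu v - im_coef k nu v) * (exp (nu * v) * exp (- nu * v))); [|ring].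
  rewrite X. ring.
Qed.

(** A crude form of Jordan's inequality, enough to compare u with sn(u) on a quarter
    period. *)
Lemma sin_ge_half (x : R) : 0 <= x <= PI / 2 -> x <= 2 * sin x.
Proof.
  intros Hx. pose proof PI_RGT_0.
  destruct (MVT_gen sin 0 (x / 2) cos) as [c [Hc E]].
  - intros t _. apply is_derive_sin.
  - intros t _. apply continuity_sin.
  - rewrite Rmin_left, Rmax_right in Hc by lra. rewrite sin_0 in E.
    assert (C : forall y, 0 <= y <= x / 2 -> sqrt 2 / 2 <= cos y).
    { intros y Hy. replace (sqrt 2 / 2) with (cos (PI / 4)).
      - apply cos_decr_1; lra.
      - rewrite cos_PI4. pose proof (sqrt_sqrt 2 ltac:(lra)).
        assert (0 < sqrt 2) by (apply sqrt_lt_R0; lra). field_simplify_eq; [|lra].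
        simpl. lra. }
    assert (0 < sqrt 2) by (apply sqrt_lt_R0; lra).
    pose proof (sqrt_sqrt 2 ltac:(lra)) as S2.
    pose proof (C c Hc) as C1. pose proof (C (x / 2) ltac:(lra)) as C2.
    replace x with (2 * (x / 2)) at 2 by field. rewrite sin_2a.
    assert (P : 1 / 2 <= cos c * cos (x / 2)).
    { replace (1 / 2) with (sqrt 2 / 2 * (sqrt 2 / 2)) by lra.
      apply Rmult_le_compat; lra. }
    replace (sin (x / 2)) with (cos c * (x / 2)) by lra.
    nra.
Qed.

Lemma u_le_sn (k u : R) : 0 < k < 1 -> 0 <= u <= ellK k -> u * comod k <= 2 * sn k u.
Proof.
  intros Hk Hu. pose proof (comod_bounds k Hk) as Hk'. pose proof (comod_sq k Hk) as E'.
  destruct (MVT_gen (am k) 0 u (dn k)) as [c [_ E]].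
  - intros t _. now apply am_derive.
  - intros t _. apply continuity_pt_filterlim. now apply am_continuous.
  - rewrite am_0 in E by exact Hk.
    assert (comod k <= dn k c).
    { apply Rsqr_incr_0; [|lra|apply Rlt_le, dn_pos, Hk].
      rewrite !Rsqr_pow2, E', dn2 by exact Hk. pose proof (cn2 k c).
      pose proof (pow2_ge_0 (cn k c)). assert (0 < k ^ 2 < 1) by nra. nra. }
    assert (am k u <= 2 * sn k u).
    { apply sin_ge_half. split; [nra|]. rewrite <- (am_K k Hk).
      destruct (Rle_lt_dec u (ellK k)); [|lra].
      destruct (Rlt_le_dec (am k (ellK k)) (am k u)) as [h|h]; [|exact h].
      pose proof (ellF_increment k _ _ Hk (Rlt_le _ _ h)). rewrite !ellF_am in H0 by exact Hk.
      lra. }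
    nra.
Qed.

Lemma one_minus_cos_le (x : R) : 0 <= x -> 0 <= 1 - cos x <= x ^ 2 / 2.
Proof.
  intros Hx. split; [pose proof (COS_bound x); lra|].
  replace (cos x) with (cos (2 * (x / 2))) by (f_equal; field).
  rewrite cos_2a_sin.
  assert (- (x / 2) <= sin (x / 2) <= x / 2).
  { destruct (Req_dec x 0) as [->|].
    - replace (0 / 2) with 0 by field. rewrite sin_0. lra.
    - split; [|apply Rlt_le, sin_lt_x; lra].
      pose proof (SIN_bound (x / 2)).
      destruct (Rle_dec (x / 2) 1).
      + assert (0 <= sin (x / 2)); [|lra]. apply sin_ge_0; [lra|].
        pose proof PI2_1. lra.
      + lra. }
  nra.
Qed.

(** Both functions are 1 + O(u^2) at u = 0, and sn(u) is at least a multiple of u on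
    the quarter period. The second order is what makes the error in
    [re_coef_concentration] vanish at the pole. *)
Lemma cos_minus_dn_le (k nu u : R) : 0 < k < 1 -> 0 <= nu -> 0 <= u <= ellK k ->
  Rabs (cos (nu * u) - dn k u) <= (2 * nu ^ 2 / comod k ^ 2 + k ^ 2) * sn k u ^ 2.
Proof.
  intros Hk Hnu Hu. pose proof (comod_bounds k Hk) as Hk'.
  destruct (one_minus_cos_le (nu * u)) as [C0 C1]; [nra|].
  pose proof (dn_pos k u Hk) as D0. pose proof (dn2 k u Hk) as D2.
  pose proof (u_le_sn k u Hk Hu) as U. pose proof (pow2_ge_0 (k * sn k u)) as S2.
  assert (0 <= 1 - dn k u <= k ^ 2 * sn k u ^ 2) by nra.
  assert ((nu * u) ^ 2 / 2 <= 2 * nu ^ 2 / comod k ^ 2 * sn k u ^ 2).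
  { assert ((u * comod k) ^ 2 <= (2 * sn k u) ^ 2).
    { apply pow_incr. split; [nra|lra]. }
    replace ((nu * u) ^ 2 / 2) with (nu ^ 2 / (2 * comod k ^ 2) * (u * comod k) ^ 2)
      by (field; lra).
    replace (2 * nu ^ 2 / comod k ^ 2 * sn k u ^ 2)
      with (nu ^ 2 / (2 * comod k ^ 2) * (2 * sn k u) ^ 2) by (field; lra).
    apply Rmult_le_compat_l; [|exact H0].
    apply Rmult_le_pos; [apply pow2_ge_0|]. apply Rlt_le, Rinv_0_lt_compat. nra. }
  rewrite Rmult_plus_distr_r.
  unfold Rabs; destruct Rcase_abs; lra.
Qed.

(** * The residue and the Fourier integrals of cn *)

(** Near v = K' the function [re_cn] is an approximate unit at u = 0. Write c, s for
    cn and sn of v with the complementary modulus: up to the factor k s, [re_cn] is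
    the derivative in u of atan(k s sn(u)/c), divided by dn(u). Replacing cos(nu u)
    by dn(u) in the integral therefore leaves atan(k s/c), and the error is O(c) by
    [cos_minus_dn_le]. *)
Lemma re_coef_concentration (k nu : R) : 0 < k < 1 -> 0 <= nu ->
  exists M, forall v, 0 < v < ellK (comod k) ->
    Rabs (k * sn (comod k) v * re_coef k nu v
          - atan (k * sn (comod k) v / cn (comod k) v))
    <= M * (cn (comod k) v / (k * sn (comod k) v)).
Proof.
  intros Hk Hnu. pose proof (comod_bounds k Hk) as Hk'. pose proof (ellK_pos k Hk) as HK.
  set (C := 2 * nu ^ 2 / comod k ^ 2 + k ^ 2).
  assert (HC : 0 <= C).
  { unfold C. pose proof (pow2_ge_0 k).
    assert (0 <= 2 * nu ^ 2 / comod k ^ 2); [|lra].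
    apply Rmult_le_pos; [pose proof (pow2_ge_0 nu); lra|].
    apply Rlt_le, Rinv_0_lt_compat. apply pow_lt. lra. }
  exists (ellK k * C). intros v Hv.
  destruct (jacobi_pos (comod k) v Hk' Hv) as [S1 C1].
  set (s1 := sn (comod k) v) in *. set (c1 := cn (comod k) v) in *.
  assert (HD : forall u, 0 < strip_den k u v) by (intros; apply strip_den_pos; fold c1; lra).
  set (da := fun u => k * s1 * c1 * (cn k u * dn k u) / strip_den k u v).
  assert (Da : forall u, is_derive (fun u => atan (k * s1 / c1 * sn k u)) u (da u)).
  { intros u. refine (is_derive_eq _ _ _ _ (is_derive_comp atan (fun u => k * s1 / c1 * sn k u) u _ _
      (is_derive_atan _) (is_derive_scal (sn k) u (k * s1 / c1) _ (sn_derive k u Hk))) _).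
    unfold scal; simpl; unfold mult; simpl.
    unfold da. pose proof (HD u) as P. unfold strip_den in *. fold s1 c1 in P |- *.
    unfold Rsqr. field. repeat split; try lra. }
  assert (Cd : forall u, continuous (fun u => strip_den k u v) u).
  { intros u. apply (continuity_2d_section (fun v u => strip_den k u v)).
    now apply strip_den_continuity. }
  assert (Cda : forall u, continuous da u).
  { intros u. unfold da, Rdiv.
    apply (continuous_mult (fun u => k * s1 * c1 * (cn k u * dn k u)) (fun u => / strip_den k u v)).
    - apply (continuous_scal_r (k * s1 * c1) (fun u => cn k u * dn k u)).
      apply (continuous_mult (cn k) (dn k)).
      + exact (continuous_of_derive _ _ _ (cn_derive k u Hk)).
      + exact (continuous_of_derive _ _ _ (dn_derive k u Hk)).
    - apply (continuous_comp (fun u => strip_den k u v) Rinv); [apply Cd|].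
      apply continuous_Rinv. apply Rgt_not_eq, HD. }
  assert (Cre : forall u, continuous (fun u => re_cn k u v * cos (nu * u)) u).
  { intros u. apply (continuous_mult (fun u => re_cn k u v)).
    - exact (continuous_of_derive _ _ _ (re_cn_derive_u k u v Hk (Rgt_not_eq _ _ (HD u)))).
    - exact (continuous_of_derive _ _ _ (proj1 (trig_derive nu u))). }
  assert (Ia : is_RInt da 0 (ellK k) (atan (k * s1 / c1))).
  { replace (atan (k * s1 / c1))
      with (minus (atan (k * s1 / c1 * sn k (ellK k))) (atan (k * s1 / c1 * sn k 0))).
    - apply (is_RInt_derive (V := R_CompleteNormedModule) (fun u => atan (k * s1 / c1 * sn k u)) da);
        intros; [apply Da | apply Cda].
    - rewrite sn_K, sn_0, Rmult_0_r, atan_0, Rmult_1_r by exact Hk.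
      unfold minus, plus, opp; simpl. ring. }
  assert (Ir : is_RInt (fun u => re_cn k u v * cos (nu * u)) 0 (ellK k) (re_coef k nu v)).
  { apply (RInt_correct (V := R_CompleteNormedModule)).
    apply (ex_RInt_continuous (V := R_CompleteNormedModule)). intros; apply Cre. }
  pose proof (is_RInt_minus _ _ _ _ _ _ (is_RInt_scal _ _ _ (k * s1) _ Ir) Ia) as I.
  set (h := fun u => minus (scal (k * s1) (re_cn k u v * cos (nu * u))) (da u)) in I.
  change (minus (scal (k * s1) (re_coef k nu v)) (atan (k * s1 / c1)))
    with (k * s1 * re_coef k nu v - atan (k * s1 / c1)) in I.
  rewrite <- (is_RInt_unique (V := R_CompleteNormedModule) _ _ _ _ I).
  replace (ellK k * C * (c1 / (k * s1))) with ((ellK k - 0) * (C * (c1 / (k * s1)))) by ring.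
  apply abs_RInt_le_const; [lra | eexists; exact I |].
  intros u Hu.
  assert (Eh : h u = k * s1 * c1 * cn k u * (cos (nu * u) - dn k u) / strip_den k u v).
  { unfold h, da, re_cn. fold c1. unfold minus, plus, opp, scal; simpl. unfold mult; simpl.
    field. apply Rgt_not_eq, HD. }
  change (Rabs (h u) <= C * (c1 / (k * s1))). rewrite Eh. unfold Rdiv. rewrite Rabs_mult, Rabs_mult.
  assert (Hcn : Rabs (cn k u) <= 1).
  { pose proof (COS_bound (am k u)). unfold cn, Rabs; destruct Rcase_abs; lra. }
  pose proof (cos_minus_dn_le k nu u Hk Hnu Hu) as B. fold C in B.
  rewrite (Rabs_right (/ strip_den k u v)) by (apply Rle_ge, Rlt_le, Rinv_0_lt_compat, HD).
  apply (Rmult_le_reg_r (strip_den k u v)); [apply HD|].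
  rewrite Rmult_assoc, Rinv_l, Rmult_1_r by (apply Rgt_not_eq, HD).
  assert (KS : 0 < k * s1) by nra.
  assert (N1 : Rabs (k * s1 * c1 * cn k u) <= k * s1 * c1).
  { rewrite Rabs_mult, (Rabs_right (k * s1 * c1)) by nra.
    assert (0 < k * s1 * c1) by nra. pose proof (Rabs_pos (cn k u)). nra. }
  apply Rle_trans with (k * s1 * c1 * (C * sn k u ^ 2)).
  { apply Rmult_le_compat; [apply Rabs_pos | apply Rabs_pos | exact N1 | exact B]. }
  unfold strip_den. fold c1 s1.
  replace (k * s1 * c1 * (C * sn k u ^ 2))
    with (C * (c1 * / (k * s1)) * (k ^ 2 * sn k u ^ 2 * s1 ^ 2)) by (field; lra).
  apply Rmult_le_compat_l.
  - apply Rmult_le_pos; [exact HC|]. apply Rmult_le_pos; [lra|].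
    apply Rlt_le, Rinv_0_lt_compat, KS.
  - pose proof (pow2_ge_0 c1). lra.
Qed.

Lemma le_0_at_right_end (f : R -> R) (a b : R) :
  a < b -> continuous f b -> (forall t, a < t < b -> f t <= 0) -> f b <= 0.
Proof.
  intros Hab Cf H. destruct (Rle_lt_dec (f b) 0) as [h|h]; [exact h|].
  destruct (proj1 (filterlim_locally _ _) Cf (mkposreal _ h)) as [d Hd].
  pose proof (cond_pos d) as Hd0.
  set (t := b - Rmin (d / 2) ((b - a) / 2)).
  assert (T : 0 < Rmin (d / 2) ((b - a) / 2) /\ Rmin (d / 2) ((b - a) / 2) <= d / 2
              /\ Rmin (d / 2) ((b - a) / 2) <= (b - a) / 2).
  { split; [apply Rmin_pos; lra | split; [apply Rmin_l | apply Rmin_r]]. }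
  assert (B : Rabs (f t - f b) < f b).
  { apply Hd. change (Rabs (t - b) < d). unfold t. rewrite Rabs_left; lra. }
  assert (f t <= 0) by (apply H; unfold t; lra).
  revert B. unfold Rabs; destruct Rcase_abs; lra.
Qed.

(** At v = K' the integral of [re_cn] against cos(nu u) tends to pi/(2k), pi/2 times
    the modulus of the residue of cn, and [re_coef_cosh] carries this value back to
    v = 0. *)
Lemma cn_fourier_integral (k nu : R) :
  0 < k < 1 -> 0 <= nu -> cos (nu * ellK k) = 0 ->
  RInt (fun u => cn k u * cos (nu * u)) 0 (ellK k)
  = PI / (k * (exp (nu * ellK (comod k)) + exp (- (nu * ellK (comod k))))).
Proof.
  intros Hk Hnu0 Hnu. pose proof (comod_bounds k Hk) as Hk'.
  pose proof (ellK_pos (comod k) Hk') as HK'.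
  destruct (re_coef_concentration k nu Hk Hnu0) as [M HM].
  set (J := RInt (fun u => cn k u * cos (nu * u)) 0 (ellK k)).
  assert (J0 : re_coef k nu 0 = J).
  { unfold re_coef, J. apply RInt_ext. intros u _.
    unfold re_cn, strip_den. rewrite sn_0, cn_0 by exact Hk'.
    as_real. field. }
  (* The bound of [re_coef_concentration] as a function of v, with atan(x) written
     as pi/2 - atan(1/x) so that it stays continuous at v = K'. *)
  set (f := fun v => Rabs (k * sn (comod k) v * (J * (exp (nu * v) + exp (- (nu * v))) / 2)
      - (PI / 2 - atan (cn (comod k) v / (k * sn (comod k) v))))
      - M * (cn (comod k) v / (k * sn (comod k) v))).
  assert (F : f (ellK (comod k)) <= 0).
  { apply (le_0_at_right_end f 0); [exact HK'| |].
    - assert (Cq : continuous (fun v => cn (comod k) v / (k * sn (comod k) v)) (ellK (comod k))).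
      { apply (ex_derive_continuous (V := R_NormedModule)).
        destruct (jacobi_ex_derive (comod k) (ellK (comod k)) Hk') as [? [? ?]].
        auto_derive. repeat split; try assumption. rewrite sn_K by exact Hk'. lra. }
      unfold f. apply (continuous_minus (U := R_UniformSpace) (V := R_NormedModule)).
      + apply (continuous_comp _ Rabs); [|apply continuous_Rabs].
        apply (continuous_minus (U := R_UniformSpace) (V := R_NormedModule)).
        * apply (ex_derive_continuous (V := R_NormedModule)).
          destruct (jacobi_ex_derive (comod k) (ellK (comod k)) Hk') as [? [? ?]].
          auto_derive. repeat split; assumption.
        * apply (continuous_minus (U := R_UniformSpace) (V := R_NormedModule)).
          -- apply continuous_const.
          -- apply (continuous_comp _ atan); [exact Cq|].
             exact (continuous_of_derive _ _ _ (is_derive_atan _)).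
      + apply (continuous_scal_r (V := R_NormedModule) M). exact Cq.
    - intros t Ht. destruct (jacobi_pos (comod k) t Hk' Ht) as [S1 C1].
      pose proof (HM t Ht) as B. unfold f.
      replace (J * (exp (nu * t) + exp (- (nu * t))) / 2) with (re_coef k nu t).
      2:{ rewrite <- J0, <- re_coef_cosh by (try assumption; lra). field. }
      rewrite <- atan_inv.
      + replace (/ (cn (comod k) t / (k * sn (comod k) t)))
          with (k * sn (comod k) t / cn (comod k) t) by (field; lra).
        lra.
      + apply Rmult_lt_0_compat; [exact C1|]. apply Rinv_0_lt_compat. nra. }
  unfold f in F. rewrite cn_K, sn_K in F by exact Hk'.
  replace (0 / (k * 1)) with 0 in F by (field; lra). rewrite atan_0 in F.
  set (E := exp (nu * ellK (comod k)) + exp (- (nu * ellK (comod k)))) in *.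
  assert (0 < E).
  { unfold E. pose proof (exp_pos (nu * ellK (comod k))).
    pose proof (exp_pos (- (nu * ellK (comod k)))). lra. }
  assert (Z : k * 1 * (J * E / 2) - (PI / 2 - 0) = 0).
  { pose proof (Rabs_pos (k * 1 * (J * E / 2) - (PI / 2 - 0))).
    destruct (Req_dec (k * 1 * (J * E / 2) - (PI / 2 - 0)) 0) as [e|ne]; [exact e|].
    apply Rabs_pos_lt in ne. lra. }
  as_real.
  apply (Rmult_eq_reg_r (k * E)); [|nra]. field_simplify; [|lra]. lra.
Qed.

(** * Bessel's inequality and integrals over a period *)

Definition continuous_on_I (a b : R) (f : R -> R) : Prop :=
  forall u, a <= u <= b -> continuous f u.

Lemma continuous_on_I_lin (a b r : R) (f g : R -> R) :
  continuous_on_I a b f -> continuous_on_I a b g ->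
  continuous_on_I a b (fun u => f u - r * g u).
Proof.
  intros Hf Hg u Hu. apply (continuous_minus f (fun u => r * g u)); [now apply Hf|].
  apply (continuous_scal_r r g). now apply Hg.
Qed.

Lemma continuous_on_I_mult (a b : R) (f g : R -> R) :
  continuous_on_I a b f -> continuous_on_I a b g ->
  continuous_on_I a b (fun u => f u * g u).
Proof.
  intros Hf Hg u Hu. apply (continuous_mult f g); auto.
Qed.

Lemma ex_RInt_on_I (a b : R) (f : R -> R) :
  a <= b -> continuous_on_I a b f -> ex_RInt f a b.
Proof.
  intros Hab Hf. apply (ex_RInt_continuous (V := R_CompleteNormedModule)).
  rewrite Rmin_left, Rmax_right by exact Hab. exact Hf.
Qed.

Definition inner (a b : R) (f g : R -> R) : R := RInt (fun u => f u * g u) a b.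

Lemma inner_lin (a b r : R) (f g h : R -> R) :
  a <= b -> continuous_on_I a b f -> continuous_on_I a b g -> continuous_on_I a b h ->
  inner a b (fun u => f u - r * g u) h = inner a b f h - r * inner a b g h.
Proof.
  intros Hab Hf Hg Hh. unfold inner.
  pose proof (RInt_correct (V := R_CompleteNormedModule) _ _ _
    (ex_RInt_on_I _ _ _ Hab (continuous_on_I_mult _ _ _ _ Hf Hh))) as I1.
  pose proof (RInt_correct (V := R_CompleteNormedModule) _ _ _
    (ex_RInt_on_I _ _ _ Hab (continuous_on_I_mult _ _ _ _ Hg Hh))) as I2.
  pose proof (is_RInt_minus _ _ _ _ _ _ I1 (is_RInt_scal _ _ _ r _ I2)) as I3.
  apply (is_RInt_unique (V := R_CompleteNormedModule)).
  refine (is_RInt_ext _ _ _ _ _ _ I3). intros u _.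
  unfold minus, plus, opp, scal; simpl. unfold mult; simpl.
  as_real. ring.
Qed.

Lemma inner_sym (a b : R) (f g : R -> R) : inner a b f g = inner a b g f.
Proof. apply RInt_ext. intros u _. apply Rmult_comm. Qed.

(** Removing from [g] its projection on [e] lowers the square of its norm by that of
    the projection. *)
Lemma bessel_step (a b c : R) (g e : R -> R) :
  a <= b -> continuous_on_I a b g -> continuous_on_I a b e ->
  0 < c -> inner a b e e = c ->
  let g' := fun u => g u - inner a b g e / c * e u in
  inner a b g' g' = inner a b g g - inner a b g e ^ 2 / c.
Proof.
  intros Hab Hg He Hc Ee g'.
  assert (Hg' : continuous_on_I a b g') by now apply continuous_on_I_lin.
  unfold g' at 1. rewrite inner_lin by assumption.
  rewrite (inner_sym _ _ g g'), (inner_sym _ _ e g'). unfold g'.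
  rewrite !inner_lin by assumption. rewrite Ee, (inner_sym _ _ e g). field. lra.
Qed.

(** The remainder of [h] after projection on e_0, ..., e_N; as its norm is not
    negative, this contains Bessel's inequality. *)
Lemma bessel_projection (a b c : R) (h : R -> R) (e : nat -> R -> R) :
  a <= b -> 0 < c -> continuous_on_I a b h -> (forall n, continuous_on_I a b (e n)) ->
  (forall n, inner a b (e n) (e n) = c) ->
  (forall n m, n <> m -> inner a b (e n) (e m) = 0) ->
  forall N, exists g, continuous_on_I a b g /\
    (forall m, (N < m)%nat -> inner a b g (e m) = inner a b h (e m)) /\
    inner a b g g = inner a b h h - sum_n (fun n => inner a b h (e n) ^ 2) N / c.
Proof.
  intros Hab Hc Hh He E1 E0. induction N as [|N [g [Cg [Pg Ng]]]].
  - exists (fun u => h u - inner a b h (e O) / c * e O u). repeat split.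
    + now apply continuous_on_I_lin.
    + intros m Hm. rewrite inner_lin by auto. rewrite E0 by lia. ring.
    + rewrite bessel_step by auto. now rewrite sum_O.
  - exists (fun u => g u - inner a b g (e (S N)) / c * e (S N) u). repeat split.
    + now apply continuous_on_I_lin.
    + intros m Hm. rewrite inner_lin by auto. rewrite E0, Pg by lia. ring.
    + rewrite bessel_step by auto. rewrite sum_Sn, Ng, Pg by lia.
      change plus with Rplus. field. lra.
Qed.

Lemma inner_ge_0 (a b : R) (g : R -> R) :
  a <= b -> continuous_on_I a b g -> 0 <= inner a b g g.
Proof.
  intros Hab Hg. apply RInt_ge_0; [exact Hab| |].
  - apply ex_RInt_on_I; [exact Hab | now apply continuous_on_I_mult].
  - intros u _. apply Rle_0_sqr.
Qed.

(** The squares of these inner products form a convergent series, by Bessel's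
    inequality. *)
Lemma riemann_lebesgue (a b c : R) (h : R -> R) (e : nat -> R -> R) :
  a <= b -> 0 < c -> continuous_on_I a b h -> (forall n, continuous_on_I a b (e n)) ->
  (forall n, inner a b (e n) (e n) = c) ->
  (forall n m, n <> m -> inner a b (e n) (e m) = 0) ->
  is_lim_seq (fun n => inner a b h (e n)) 0.
Proof.
  intros Hab Hc Hh He E1 E0.
  set (sq := fun n => inner a b h (e n) ^ 2).
  assert (B : forall N, sum_n sq N <= c * inner a b h h).
  { intros N. destruct (bessel_projection a b c h e Hab Hc Hh He E1 E0 N) as [g [Cg [_ Ng]]].
    pose proof (inner_ge_0 a b g Hab Cg) as P. rewrite Ng in P. fold sq in P.
    apply (Rmult_le_reg_r (/ c)); [now apply Rinv_0_lt_compat|].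
    replace (c * inner a b h h * / c) with (inner a b h h) by (field; lra).
    unfold Rdiv in P. lra. }
  assert (S : is_lim_seq sq 0).
  { apply ex_series_lim_0.
    destruct (ex_finite_lim_seq_incr (sum_n sq) (c * inner a b h h)) as [l Hl].
    - intros n. rewrite sum_Sn. change plus with Rplus. unfold sq at 3.
      pose proof (pow2_ge_0 (inner a b h (e (Datatypes.S n)))). lra.
    - exact B.
    - exists l. exact Hl. }
  apply is_lim_seq_spec. apply is_lim_seq_spec in S. intros eps.
  destruct (S (mkposreal (eps ^ 2) (pow_lt _ 2 (cond_pos eps)))) as [N HN].
  exists N. intros n Hn. specialize (HN n Hn). simpl in HN. unfold sq in HN.
  rewrite Rminus_0_r in *. pose proof (cond_pos eps).
  rewrite Rabs_right in HN by (apply Rle_ge, pow2_ge_0).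
  rewrite <- (Rabs_right eps) by lra. apply Rsqr_lt_abs_0. unfold Rsqr. lra.
Qed.

(** Difference quotient at 0, completed by the derivative [l]. *)
Definition slope (f : R -> R) (l u : R) : R := if Req_EM_T u 0 then l else f u / u.

Lemma slope_mul (f : R -> R) (l u : R) : f 0 = 0 -> slope f l u * u = f u.
Proof.
  intros H. unfold slope. destruct (Req_EM_T u 0) as [->|]; [rewrite H; ring | now field].
Qed.

Lemma slope_continuous (f : R -> R) (l u : R) :
  (forall u, continuous f u) -> is_derive f 0 l -> f 0 = 0 -> continuous (slope f l) u.
Proof.
  intros Cf Df F0. destruct (Req_dec u 0) as [->|Hu].
  - apply filterlim_locally. intros eps.
    apply is_derive_Reals in Df. destruct (Df eps (cond_pos eps)) as [d Hd].
    exists d. intros y Hy. change (Rabs (y - 0) < d) in Hy. rewrite Rminus_0_r in Hy.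
    change (Rabs (slope f l y - slope f l 0) < eps). unfold slope.
    destruct (Req_EM_T 0 0); [|lra]. destruct (Req_EM_T y 0).
    + rewrite Rminus_diag, Rabs_R0. apply cond_pos.
    + specialize (Hd y n Hy). now rewrite F0, Rplus_0_l, Rminus_0_r in Hd.
  - apply (continuous_ext_loc _ (fun u => f u * / u)).
    + assert (L : locally u (fun y => y <> 0)) by now apply open_neq.
      refine (filter_imp _ _ _ L). intros y Hy. unfold slope.
      destruct (Req_EM_T y 0); [contradiction | reflexivity].
    + apply (continuous_mult f Rinv); [apply Cf | now apply continuous_Rinv].
Qed.

Lemma antiderivative_exists (f : R -> R) :
  (forall u, continuous f u) ->
  exists F, (forall u, is_derive F u (f u)) /\ forall a b, is_RInt f a b (F b - F a).
Proof.
  intros Cf. exists (fun y => RInt f 0 y).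
  assert (D : forall u, is_derive (fun y => RInt f 0 y) u (f u)).
  { intros u. apply (is_derive_RInt (V := R_CompleteNormedModule) f _ 0); [|apply Cf].
    apply filter_forall. intros y. apply (RInt_correct (V := R_CompleteNormedModule)).
    apply (ex_RInt_continuous (V := R_CompleteNormedModule)). intros; apply Cf. }
  split; [exact D|]. intros a b.
  apply (is_RInt_derive (V := R_CompleteNormedModule) (fun y => RInt f 0 y) f); intros; auto.
Qed.

Lemma is_derive_shift (F f : R -> R) (c u : R) :
  (forall u, is_derive F u (f u)) -> is_derive (fun u => F (u + c)) u (f (u + c)).
Proof.
  intros H. refine (is_derive_eq _ _ _ _ (is_derive_comp F (fun u => u + c) u _ 1 (H _) _) _).
  - auto_derive; [exact I | reflexivity].
  - unfold scal; simpl; unfold mult; simpl. ring.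
Qed.

Lemma is_derive_reflect (F f : R -> R) (u : R) :
  (forall u, is_derive F u (f u)) -> is_derive (fun u => F (- u)) u (- f (- u)).
Proof.
  intros H. refine (is_derive_eq _ _ _ _ (is_derive_comp F (fun u => - u) u _ (-1) (H _) _) _).
  - auto_derive; [exact I | reflexivity].
  - unfold scal; simpl; unfold mult; simpl. ring.
Qed.

(** Angular frequency of the first harmonic of cn, whose period is 4K; only its odd
    multiples occur in the expansion of cn. *)
Definition freq (k : R) : R := PI / (2 * ellK k).

Lemma odd_freq_shift (k : R) (n : nat) (t : R) : 0 < k < 1 ->
  cos ((2 * INR n + 1) * freq k * (t + 2 * ellK k)) = - cos ((2 * INR n + 1) * freq k * t) /\
  sin ((2 * INR n + 1) * freq k * (t + 2 * ellK k)) = - sin ((2 * INR n + 1) * freq k * t).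
Proof.
  intros Hk. pose proof (ellK_pos k Hk).
  replace ((2 * INR n + 1) * freq k * (t + 2 * ellK k))
    with ((2 * INR n + 1) * freq k * t + PI + 2 * INR n * PI) by (unfold freq; field; lra).
  now rewrite cos_period, sin_period, neg_cos, neg_sin.
Qed.

Lemma cos_odd_freq_K (k : R) (n : nat) : 0 < k < 1 ->
  cos ((2 * INR n + 1) * freq k * ellK k) = 0.
Proof.
  intros Hk. pose proof (ellK_pos k Hk).
  replace ((2 * INR n + 1) * freq k * ellK k) with (PI / 2 + INR n * PI)
    by (unfold freq; field; lra).
  rewrite cos_plus, cos_PI2, sin_PI2.
  enough (sin (INR n * PI) = 0) by (rewrite H0; ring).
  apply sin_eq_0_1. exists (Z.of_nat n). now rewrite INR_IZR_INZ.
Qed.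

Lemma cos_freq_integral (k : R) (n : nat) : 0 < k < 1 ->
  is_RInt (fun u => cos (2 * INR n * freq k * u)) (- ellK k) (ellK k)
    (if (n =? 0)%nat then 2 * ellK k else 0).
Proof.
  intros Hk. pose proof (ellK_pos k Hk) as HK. pose proof PI_RGT_0.
  destruct n as [|n]; simpl Nat.eqb; cbv iota.
  - apply (is_RInt_ext (fun _ => 1)).
    + intros u _. simpl INR. rewrite Rmult_0_r, !Rmult_0_l, cos_0. reflexivity.
    + replace (2 * ellK k) with (scal (ellK k - - ellK k) 1).
      * apply (is_RInt_const (V := R_NormedModule)).
      * unfold scal; simpl; unfold mult; simpl. ring.
  - set (r := 2 * INR (S n) * freq k).
    assert (Hr : 0 < r).
    { unfold r, freq. pose proof (lt_0_INR (S n) ltac:(lia)).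
      apply Rmult_lt_0_compat; [lra|]. apply Rdiv_lt_0_compat; lra. }
    assert (Z : sin (r * ellK k) = 0).
    { replace (r * ellK k) with (INR (S n) * PI) by (unfold r, freq; field; lra).
      apply sin_eq_0_1. exists (Z.of_nat (S n)). now rewrite INR_IZR_INZ. }
    replace 0 with (minus (sin (r * ellK k) / r) (sin (r * - ellK k) / r)).
    2:{ rewrite <- Ropp_mult_distr_r, sin_neg, Z. unfold minus, plus, opp; simpl. field. lra. }
    apply (is_RInt_derive (V := R_CompleteNormedModule) (fun u => sin (r * u) / r)).
    + intros u _. auto_derive; [lra|]. field. lra.
    + intros u _. exact (continuous_of_derive _ _ _ (proj1 (trig_derive r u))).
Qed.

(** The integrand is 2K-periodic, since cn and the odd harmonics change sign under a
    shift by 2K; so the interval of integration can be translated by x, and the sine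
    part vanishes by parity. *)
Lemma cn_translate_integral (k x : R) (n : nat) : 0 < k < 1 ->
  let nu := (2 * INR n + 1) * freq k in
  is_RInt (fun u => cn k (u + x) * cos (nu * u)) (- ellK k) (ellK k)
    (2 * RInt (fun u => cn k u * cos (nu * u)) 0 (ellK k) * cos (nu * x)).
Proof.
  intros Hk nu.
  assert (Ccn : forall u, continuous (cn k) u).
  { intros u. exact (continuous_of_derive _ _ _ (cn_derive k u Hk)). }
  destruct (antiderivative_exists (fun u => cn k u * cos (nu * u))) as [C [DC IC]].
  { intros u. apply (continuous_mult (cn k)); [apply Ccn|].
    exact (continuous_of_derive _ _ _ (proj1 (trig_derive nu u))). }
  destruct (antiderivative_exists (fun u => cn k u * sin (nu * u))) as [S [DS IS]].
  { intros u. apply (continuous_mult (cn k)); [apply Ccn|].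
    exact (continuous_of_derive _ _ _ (proj2 (trig_derive nu u))). }
  rewrite (is_RInt_unique (V := R_CompleteNormedModule) _ _ _ _ (IC 0 (ellK k))).
  set (K := ellK k) in *.
  assert (EC : C (x + K) - C (x + - K) = 2 * (C K - C 0)).
  { transitivity (C (0 + K) - C (0 + - K)).
    - apply (const_of_derive0 (fun x => C (x + K) - C (x + - K))). intros t.
      refine (is_derive_eq _ _ _ _ (is_derive_minus _ _ t _ _
        (is_derive_shift C _ K t DC) (is_derive_shift C _ (- K) t DC)) _).
      change minus with Rminus. cbv beta.
      replace (t + K) with (t + - K + 2 * K) by ring. unfold K, nu.
      rewrite cn_shift by exact Hk. rewrite (proj1 (odd_freq_shift k n _ Hk)).
      as_real. ring.
    - rewrite !Rplus_0_l.
      assert (Ev : C K + C (- K) = C 0 + C (- 0)).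
      { apply (const_of_derive0 (fun t => C t + C (- t))). intros t.
        refine (is_derive_eq _ _ _ _ (is_derive_plus _ _ t _ _
          (DC t) (is_derive_reflect C _ t DC)) _).
        change plus with Rplus. cbv beta. rewrite cn_opp by exact Hk.
        replace (nu * - t) with (- (nu * t)) by ring. rewrite cos_neg.
        as_real. ring. }
      rewrite Ropp_0 in Ev. lra. }
  assert (ES : S (x + K) - S (x + - K) = 0).
  { transitivity (S (0 + K) - S (0 + - K)).
    - apply (const_of_derive0 (fun x => S (x + K) - S (x + - K))). intros t.
      refine (is_derive_eq _ _ _ _ (is_derive_minus _ _ t _ _
        (is_derive_shift S _ K t DS) (is_derive_shift S _ (- K) t DS)) _).
      change minus with Rminus. cbv beta.
      replace (t + K) with (t + - K + 2 * K) by ring. unfold K, nu.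
      rewrite cn_shift by exact Hk. rewrite (proj2 (odd_freq_shift k n _ Hk)).
      as_real. ring.
    - rewrite !Rplus_0_l.
      assert (Ev : S K - S (- K) = S 0 - S (- 0)).
      { apply (const_of_derive0 (fun t => S t - S (- t))). intros t.
        refine (is_derive_eq _ _ _ _ (is_derive_minus _ _ t _ _
          (DS t) (is_derive_reflect S _ t DS)) _).
        change minus with Rminus. cbv beta. rewrite cn_opp by exact Hk.
        replace (nu * - t) with (- (nu * t)) by ring. rewrite sin_neg.
        as_real. ring. }
      rewrite Ropp_0 in Ev. lra. }
  replace (2 * (C K - C 0) * cos (nu * x))
    with (minus (C (K + x) * cos (nu * x) + S (K + x) * sin (nu * x))
                (C (- K + x) * cos (nu * x) + S (- K + x) * sin (nu * x))).
  2:{ rewrite <- EC, !(Rplus_comm _ x). change minus with Rminus.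
      replace (S (x + K)) with (S (x + - K)) by lra.
      as_real. ring. }
  apply (is_RInt_derive (V := R_CompleteNormedModule)
           (fun u => C (u + x) * cos (nu * x) + S (u + x) * sin (nu * x))).
  - intros u _.
    refine (is_derive_eq _ _ _ _ (is_derive_plus (fun u => C (u + x) * cos (nu * x))
       (fun u => S (u + x) * sin (nu * x)) u _ _
       (is_derive_Rmult _ (fun _ => cos (nu * x)) _ _ 0 _ (is_derive_shift C _ x u DC)
         (is_derive_const _ _) eq_refl)
       (is_derive_Rmult _ (fun _ => sin (nu * x)) _ _ 0 _ (is_derive_shift S _ x u DS)
         (is_derive_const _ _) eq_refl)) _).
    change plus with Rplus. cbv beta.
    replace (nu * u) with (nu * (u + x) - nu * x) by ring. rewrite cos_minus.
    as_real. ring.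
  - intros u _. apply (continuous_mult (fun u => cn k (u + x))).
    + exact (continuous_of_derive _ _ _ (is_derive_shift (cn k) _ x u (fun u => cn_derive k u Hk))).
    + exact (continuous_of_derive _ _ _ (proj1 (trig_derive nu u))).
Qed.

(** * Pointwise convergence of the Fourier series of cn *)

Definition even_sine (k : R) (n : nat) (u : R) : R := sin (2 * INR n * freq k * u).

Lemma even_sine_continuous (k a b : R) (n : nat) : continuous_on_I a b (even_sine k n).
Proof. intros u _. exact (continuous_of_derive _ _ _ (proj2 (trig_derive _ u))). Qed.

(** Indices are shifted by one because [even_sine] with index 0 is zero. *)
Lemma even_sine_inner (k : R) (n m : nat) : 0 < k < 1 ->
  inner (- ellK k) (ellK k) (even_sine k (S n)) (even_sine k (S m))
  = if (n =? m)%nat then ellK k else 0.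
Proof.
  intros Hk. pose proof (ellK_pos k Hk) as HK.
  assert (G : forall n d, inner (- ellK k) (ellK k) (even_sine k (S n)) (even_sine k (S (n + d)))
    = if (d =? 0)%nat then ellK k else 0).
  { clear n m. intros n d. unfold inner. apply (is_RInt_unique (V := R_CompleteNormedModule)).
    pose proof (cos_freq_integral k d Hk) as I1.
    pose proof (cos_freq_integral k (S n + S (n + d)) Hk) as I2.
    replace (S n + S (n + d) =? 0)%nat with false in I2 by (symmetry; apply Nat.eqb_neq; lia).
    replace (if (d =? 0)%nat then ellK k else 0)
      with (scal (/ 2) (minus (if (d =? 0)%nat then 2 * ellK k else 0) 0)).
    - refine (is_RInt_ext _ _ _ _ _ _ (is_RInt_scal _ _ _ (/ 2) _ (is_RInt_minus _ _ _ _ _ _ I1 I2))).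
      intros u _. unfold even_sine. change minus with Rminus. change (scal ?p ?q) with (Rmult p q).
      replace (2 * INR d * freq k * u)
        with (2 * INR (S (n + d)) * freq k * u - 2 * INR (S n) * freq k * u)
        by (rewrite !S_INR, plus_INR; ring).
      replace (2 * INR (S n + S (n + d)) * freq k * u)
        with (2 * INR (S (n + d)) * freq k * u + 2 * INR (S n) * freq k * u)
        by (rewrite plus_INR; ring).
      rewrite cos_minus, cos_plus.
      as_real. field.
    - change minus with Rminus. change (scal ?p ?q) with (Rmult p q).
      as_real.
      destruct (d =? 0)%nat; field. }
  destruct (le_ge_dec n m) as [h|h].
  - replace m with (n + (m - n))%nat at 1 by lia. rewrite G.
    destruct (Nat.eqb_spec (m - n) 0), (Nat.eqb_spec n m); try reflexivity; lia.
  - rewrite inner_sym. replace n with (m + (n - m))%nat at 1 by lia. rewrite G.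
    destruct (Nat.eqb_spec (n - m) 0), (Nat.eqb_spec n m); try reflexivity; lia.
Qed.

(** Chernoff's proof of pointwise convergence. The function cn(u + x) - cn(x) cos(mu
    u), where mu = [freq k], vanishes at u = 0, hence equals h(u) sin(mu u) with h
    continuous on [-K,K]. Since sin(mu u) cos((2n+1) mu u) is half the difference of
    two consecutive even sines, the partial sums of its Fourier series telescope to
    one inner product of h with an even sine, which tends to 0. *)
Lemma cn_fourier_series (k x : R) : 0 < k < 1 ->
  is_series (fun n => 2 / ellK k
      * RInt (fun u => cn k u * cos ((2 * INR n + 1) * freq k * u)) 0 (ellK k)
      * cos ((2 * INR n + 1) * freq k * x)) (cn k x).
Proof.
  intros Hk. pose proof (ellK_pos k Hk) as HK. set (K := ellK k) in *.
  assert (Hf : 0 < freq k).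
  { unfold freq. pose proof PI_RGT_0. apply Rdiv_lt_0_compat; fold K; lra. }
  assert (HfK : freq k * K = PI / 2) by (unfold freq; fold K; field; lra).
  set (F := fun u => cn k (u + x) - cn k x * cos (freq k * u)).
  set (Sn := fun u => sin (freq k * u)).
  assert (DF : forall u, exists l, is_derive F u l).
  { intros u. eexists. unfold F.
    apply (is_derive_minus (fun u => cn k (u + x)) (fun u => cn k x * cos (freq k * u))).
    - exact (is_derive_shift (cn k) _ x u (fun u => cn_derive k u Hk)).
    - exact (is_derive_scal _ _ (cn k x) _ (proj1 (trig_derive (freq k) u))). }
  assert (CF : forall u, continuous F u).
  { intros u. destruct (DF u) as [l Hl]. exact (continuous_of_derive _ _ _ Hl). }
  assert (CS : forall u, continuous Sn u).
  { intros u. exact (continuous_of_derive _ _ _ (proj2 (trig_derive (freq k) u))). }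
  destruct (DF 0) as [l Hl].
  assert (F0 : F 0 = 0).
  { unfold F. rewrite Rplus_0_l, Rmult_0_r, cos_0. ring. }
  assert (S0 : Sn 0 = 0) by (unfold Sn; rewrite Rmult_0_r; apply sin_0).
  assert (DS : is_derive Sn 0 (freq k)).
  { refine (is_derive_eq _ _ _ _ (proj2 (trig_derive (freq k) 0)) _).
    rewrite Rmult_0_r, cos_0. ring. }
  assert (NS : forall u, - K <= u <= K -> slope Sn (freq k) u <> 0).
  { intros u Hu. unfold slope. destruct (Req_EM_T u 0) as [e|ne]; [lra|].
    apply Rmult_integral_contrapositive. split; [|now apply Rinv_neq_0_compat].
    unfold Sn. pose proof PI_RGT_0. destruct (Rlt_le_dec u 0).
    - apply Rlt_not_eq. apply sin_lt_0_var; nra.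
    - apply Rgt_not_eq. apply sin_gt_0; nra. }
  set (h := fun u => slope F l u * / slope Sn (freq k) u).
  assert (Ch : continuous_on_I (- K) K h).
  { intros u Hu. apply (continuous_mult (slope F l) (fun u => / slope Sn (freq k) u)).
    - now apply slope_continuous.
    - apply (continuous_comp (slope Sn (freq k)) Rinv);
        [now apply slope_continuous | now apply continuous_Rinv, NS]. }
  assert (Eh : forall u, - K <= u <= K -> h u * Sn u = F u).
  { intros u Hu. unfold h. rewrite <- (slope_mul Sn (freq k) u S0) , <- (slope_mul F l u F0).
    field. now apply NS. }
  set (t := fun n => inner (- K) K h (even_sine k n)).
  set (I := fun n => RInt (fun u => cn k u * cos ((2 * INR n + 1) * freq k * u)) 0 K).
  assert (Step : forall n, 2 * I n * cos ((2 * INR n + 1) * freq k * x)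
                 = cn k x * (if (n =? 0)%nat then K else 0) + (t (S n) - t n) / 2).
  { intros n. pose proof (cn_translate_integral k x n Hk) as I1. cbv zeta in I1. fold K in I1.
    fold (I n) in I1.
    pose proof (cos_freq_integral k n Hk) as I2. fold K in I2.
    pose proof (cos_freq_integral k (S n) Hk) as I3. fold K in I3. simpl Nat.eqb in I3.
    cbv iota in I3.
    assert (It : forall n, is_RInt (fun u => h u * even_sine k n u) (- K) K (t n)).
    { intros m. apply (RInt_correct (V := R_CompleteNormedModule)).
      apply ex_RInt_on_I; [lra|]. apply continuous_on_I_mult;
        [exact Ch | apply even_sine_continuous]. }
    pose proof (is_RInt_scal _ _ _ (/ 2) _ (is_RInt_minus _ _ _ _ _ _ (It (S n)) (It n))) as I4.
    pose proof (is_RInt_minus _ _ _ _ _ _ I1 (is_RInt_scal _ _ _ (cn k x / 2) _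
                 (is_RInt_plus _ _ _ _ _ _ I3 I2))) as I5.
    apply (is_RInt_ext _ (fun u => F u * cos ((2 * INR n + 1) * freq k * u))) in I4.
    2:{ rewrite Rmin_left, Rmax_right by lra. intros u Hu. rewrite <- Eh by lra.
        change minus with Rminus. change (scal ?p ?q) with (Rmult p q). unfold even_sine, Sn.
        replace (2 * INR (S n) * freq k * u)
          with ((2 * INR n + 1) * freq k * u + freq k * u) by (rewrite S_INR; ring).
        replace (2 * INR n * freq k * u)
          with ((2 * INR n + 1) * freq k * u - freq k * u) by ring.
        rewrite sin_plus, sin_minus.
        as_real. field. }
    apply (is_RInt_ext _ (fun u => F u * cos ((2 * INR n + 1) * freq k * u))) in I5.
    2:{ intros u _. change minus with Rminus. change plus with Rplus.
        change (scal ?p ?q) with (Rmult p q). unfold F.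
        replace (2 * INR (S n) * freq k * u)
          with ((2 * INR n + 1) * freq k * u + freq k * u) by (rewrite S_INR; ring).
        replace (2 * INR n * freq k * u)
          with ((2 * INR n + 1) * freq k * u - freq k * u) by ring.
        rewrite cos_plus, cos_minus.
        as_real. field. }
    apply (is_RInt_unique (V := R_CompleteNormedModule)) in I4.
    apply (is_RInt_unique (V := R_CompleteNormedModule)) in I5.
    pose proof (eq_trans (eq_sym I5) I4) as E.
    change minus with Rminus in E. change plus with Rplus in E.
    unfold scal in E; simpl in E. unfold mult in E; simpl in E.
    match type of E with ?a = ?b => change (@eq R a b) in E end.
    destruct (n =? 0)%nat; lra. }
  (* Only the term n = 0 meets the integral of cos(mu u)^2; the differences of inner
     products telescope. *)
  assert (Sum : forall N, sum_n (fun n => 2 / K * I n * cos ((2 * INR n + 1) * freq k * x)) N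
                = cn k x + t (S N) / (2 * K)).
  { assert (T0 : t O = 0).
    { unfold t, inner. rewrite (RInt_ext _ (fun _ => 0)).
      - rewrite (RInt_const (V := R_CompleteNormedModule)). unfold scal; simpl.
        unfold mult; simpl. ring.
      - intros u _. unfold even_sine. simpl INR. rewrite Rmult_0_r, !Rmult_0_l, sin_0.
        as_real. ring. }
    induction N as [|N IH].
    - rewrite sum_O. pose proof (Step O) as E. simpl Nat.eqb in E. cbv iota in E.
      rewrite T0 in E. replace (2 / K * I O * cos ((2 * INR 0 + 1) * freq k * x))
        with (2 * I O * cos ((2 * INR 0 + 1) * freq k * x) / K) by (field; lra).
      rewrite E. as_real. field. lra.
    - rewrite sum_Sn, IH. change plus with Rplus. pose proof (Step (S N)) as E.
      simpl Nat.eqb in E. cbv iota in E.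
      replace (2 / K * I (S N) * cos ((2 * INR (S N) + 1) * freq k * x))
        with (2 * I (S N) * cos ((2 * INR (S N) + 1) * freq k * x) / K) by (field; lra).
      rewrite E. as_real. field. lra. }
  assert (RL : is_lim_seq (fun n => t (S n)) 0).
  { apply (riemann_lebesgue (- K) K K h (fun n => even_sine k (S n))); try assumption; try lra.
    - intros n. apply even_sine_continuous.
    - intros n. unfold K. rewrite even_sine_inner by exact Hk. now rewrite Nat.eqb_refl.
    - intros n m Hnm. unfold K. rewrite even_sine_inner by exact Hk.
      now apply Nat.eqb_neq in Hnm as ->. }
  assert (L : is_lim_seq (fun N => cn k x + t (S N) / (2 * K)) (cn k x)).
  { replace (Finite (cn k x)) with (Finite (cn k x + 0 / (2 * K)))
      by (f_equal; field; lra).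
    apply (is_lim_seq_plus' (fun _ => cn k x)); [apply is_lim_seq_const|].
    apply (is_lim_seq_scal_r (fun N => t (S N)) (/ (2 * K)) 0). exact RL. }
  apply (is_lim_seq_ext _ _ _ (fun N => eq_sym (Sum N))) in L. exact L.
Qed.

(** * The moments of the discrete measure *)

Lemma bilateral_ext (a b : Z -> R) (l m : R) :
  (forall s, a s = b s) -> l = m -> is_bilateral_series a l -> is_bilateral_series b m.
Proof.
  intros E <- [l1 [l2 [H1 [H2 H3]]]]. exists l1, l2. repeat split; [| |exact H3].
  - refine (is_series_ext _ _ _ _ H1). intros; apply E.
  - refine (is_series_ext _ _ _ _ H2). intros; apply E.
Qed.

Lemma bilateral_lin (a b : Z -> R) (l m r q : R) :
  is_bilateral_series a l -> is_bilateral_series b m ->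
  is_bilateral_series (fun s => r * a s + q * b s) (r * l + q * m).
Proof.
  intros [l1 [l2 [H1 [H2 H3]]]] [m1 [m2 [G1 [G2 G3]]]].
  exists (r * l1 + q * m1), (r * l2 + q * m2). repeat split.
  - exact (is_series_plus _ _ _ _ (is_series_scal r _ _ H1) (is_series_scal q _ _ G1)).
  - exact (is_series_plus _ _ _ _ (is_series_scal r _ _ H2) (is_series_scal q _ _ G2)).
  - rewrite H3, G3. ring.
Qed.

(** The reflection s -> 1 - s exchanges the points s - 1/2 and - (s - 1/2), so that
    the bilateral sum is twice the sum over s >= 1. *)
Lemma weight_cos_symmetric (k x : R) (s : Z) :
  weight k (1 - s) * cos (PI * x * (IZR (1 - s) - / 2) / ellK k)
  = weight k s * cos (PI * x * (IZR s - / 2) / ellK k).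
Proof.
  rewrite minus_IZR. unfold weight. rewrite minus_IZR.
  replace (PI * x * (1 - IZR s - / 2) / ellK k) with (- (PI * x * (IZR s - / 2) / ellK k))
    by (replace (1 - IZR s - / 2) with (- (IZR s - / 2)) by field; unfold Rdiv; ring).
  rewrite cos_neg. f_equal. f_equal. f_equal.
  rewrite Rplus_comm. f_equal; f_equal; field.
Qed.

(** With nu = (2n+1) pi/(2K), the exponentials exp(-nu K') and exp(nu K') are the
    powers of the nome with exponents n + 1/2 and - (n + 1/2). *)
Lemma weight_fourier (k x : R) (n : nat) : 0 < k < 1 ->
  2 / ellK k * RInt (fun u => cn k u * cos ((2 * INR n + 1) * freq k * u)) 0 (ellK k)
  * cos ((2 * INR n + 1) * freq k * x)
  = 2 * (weight k (Z.of_nat (S n)) * cos (PI * x * (IZR (Z.of_nat (S n)) - / 2) / ellK k)).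
Proof.
  intros Hk. pose proof (ellK_pos k Hk) as HK. pose proof PI_RGT_0.
  set (nu := (2 * INR n + 1) * freq k).
  assert (Hnu : 0 <= nu).
  { unfold nu, freq. apply Rmult_le_pos; [pose proof (pos_INR n); lra|].
    apply Rlt_le, Rdiv_lt_0_compat; lra. }
  rewrite (cn_fourier_integral k nu Hk Hnu (cos_odd_freq_K k n Hk)).
  rewrite <- INR_IZR_INZ, S_INR. unfold weight. rewrite <- INR_IZR_INZ, S_INR.
  replace (PI * x * (INR n + 1 - / 2) / ellK k) with (nu * x) by (unfold nu, freq; field; lra).
  replace (Rpower (nome k) (INR n + 1 - / 2)) with (exp (- (nu * ellK (comod k)))).
  replace (Rpower (nome k) (- (INR n + 1) + / 2)) with (exp (nu * ellK (comod k))).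
  - pose proof (exp_pos (nu * ellK (comod k))). pose proof (exp_pos (- (nu * ellK (comod k)))).
    as_real. field. lra.
  - unfold Rpower, nome. rewrite ln_exp. f_equal. fold (comod k). unfold nu, freq. field. lra.
  - unfold Rpower, nome. rewrite ln_exp. f_equal. fold (comod k). unfold nu, freq. field. lra.
Qed.

(** The points s >= 1 and the points s <= 0 contribute half of the Fourier series of
    cn each; the term s = 0 moves from the second half to the first because the
    series over [nat] begins there. *)
Lemma cn_bilateral (k x : R) : 0 < k < 1 ->
  is_bilateral_series
    (fun s => weight k s * cos (PI * x * (IZR s - / 2) / ellK k)) (cn k x).
Proof.
  intros Hk.
  set (g := fun s => weight k s * cos (PI * x * (IZR s - / 2) / ellK k)).
  pose proof (cn_fourier_series k x Hk) as S.
  apply (is_series_scal (/ 2)) in S.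
  apply (is_series_ext _ (fun n => g (Z.of_nat (Datatypes.S n)))) in S.
  2:{ intros n. rewrite (weight_fourier k x n Hk). change (scal ?p ?q) with (Rmult p q).
      unfold g. as_real. field. }
  change (scal ?p ?q) with (Rmult p q) in S.
  assert (Sym : forall n : nat, g (- Z.of_nat n)%Z = g (Z.of_nat (Datatypes.S n))).
  { intros n. unfold g. rewrite <- weight_cos_symmetric.
    now replace (1 - - Z.of_nat n)%Z with (Z.of_nat (Datatypes.S n)) by lia. }
  exists (/ 2 * cn k x + g 0%Z), (/ 2 * cn k x - g 0%Z). repeat split.
  - apply is_series_decr_1. change plus with Rplus. change opp with Ropp.
    replace (/ 2 * cn k x + g 0%Z + - g (Z.of_nat 0)) with (/ 2 * cn k x)
      by (change (Z.of_nat 0) with 0%Z; ring).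
    exact S.
  - apply (is_series_ext (fun n => g (Z.of_nat (Datatypes.S (Datatypes.S n))))).
    + intros n. now rewrite Sym.
    + apply (is_series_incr_1 (fun n => g (Z.of_nat (Datatypes.S n)))).
      change plus with Rplus. rewrite <- (Sym O). change (- Z.of_nat 0)%Z with 0%Z.
      replace (/ 2 * cn k x - g 0%Z + g 0%Z) with (/ 2 * cn k x) by ring. exact S.
  - field.
Qed.

(** * Szego's recurrence on the unit circle *)

Definition dn_or_cn (k : R) (n : nat) : R -> R := if Nat.even n then dn k else cn k.

Definition verblunsky (k w : R) (n : nat) : R := (-1) ^ n * dn_or_cn k (S n) (w * (INR n + 1)).

(** Real and imaginary part of z^{-n/2} Phi_n(z) at z = exp(i theta). With this
    normalization z^n Phi_n(1/z) becomes the complex conjugate, so that Szego's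
    recurrence rotates by theta/2 and then scales the two parts by 1 - a_n and 1 +
    a_n. *)
Fixpoint szego (k w theta : R) (n : nat) : R * R :=
  match n with
  | O => (1, 0)
  | S m =>
      let a := verblunsky k w m in
      let p := szego k w theta m in
      ((1 - a) * (cos (theta / 2) * fst p - sin (theta / 2) * snd p),
       (1 + a) * (sin (theta / 2) * fst p + cos (theta / 2) * snd p))
  end.

Lemma verblunsky_even (k w : R) (n : nat) :
  verblunsky k w (2 * n) = cn k (w * (2 * INR n + 1)).
Proof.
  unfold verblunsky, dn_or_cn. rewrite Nat.even_succ, Nat.odd_even, pow_1_even, mult_INR, Rmult_1_l.
  reflexivity.
Qed.

Lemma verblunsky_odd (k w : R) (n : nat) :
  verblunsky k w (S (2 * n)) = - dn k (2 * w * INR (S n)).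
Proof.
  unfold verblunsky, dn_or_cn. rewrite !Nat.even_succ, Nat.odd_succ, Nat.even_even, pow_1_odd.
  replace (w * (INR (S (2 * n)) + 1)) with (2 * w * INR (S n))
    by (rewrite !S_INR, mult_INR; simpl INR; ring).
  cbv iota. ring.
Qed.

(** Two half-angle rotations make one full rotation, and only cos(theta) and
    sin(theta) remain. *)
Lemma szego_two_step (k w theta : R) (n : nat) :
  let p := szego k w theta (2 * n) in
  let g := cn k (w * (2 * INR n + 1)) in
  let d := dn k (2 * w * INR (S n)) in
  szego k w theta (2 * S n)
  = ((1 + d) * ((cos theta - g) * fst p - sin theta * snd p),
     (1 - d) * (sin theta * fst p + (cos theta + g) * snd p)).
Proof.
  intros p g d. replace (2 * S n)%nat with (S (S (2 * n))) by lia.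
  cbn [szego fst snd]. rewrite verblunsky_odd, verblunsky_even. fold p g d.
  replace (cos theta) with (cos (2 * (theta / 2))) by (f_equal; field).
  replace (sin theta) with (sin (2 * (theta / 2))) by (f_equal; field).
  rewrite cos_2a, sin_2a.
  pose proof (sin2_cos2 (theta / 2)) as T. unfold Rsqr in T.
  assert (T' : cos (theta / 2) ^ 2 = 1 - sin (theta / 2) ^ 2) by lra.
  f_equal; ring [T'].
Qed.

(** Geronimus' relations. Eliminating the imaginary part from two consecutive double
    steps of Szego's recurrence gives the three-term recurrence with the
    coefficients [coef_b] and [coef_u]; the square of sn in [coef_u] is 1 -
    a_{2n}^2. *)
Lemma P_szego (k w theta : R) (n : nat) : 0 < k < 1 ->
  P k w n (cos theta)
  = 2 * (/ 2) ^ n * fst (szego k w theta (2 * n)) / (1 + dn k (2 * w * INR n)).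
Proof.
  intros Hk.
  assert (D : forall u, 0 < dn k u) by (intros; now apply dn_pos).
  enough (H : P k w n (cos theta)
  = 2 * (/ 2) ^ n * fst (szego k w theta (2 * n)) / (1 + dn k (2 * w * INR n)) /\
    P k w (S n) (cos theta)
  = 2 * (/ 2) ^ S n * fst (szego k w theta (2 * S n)) / (1 + dn k (2 * w * INR (S n))))
    by apply H.
  induction n as [|n [IH0 IH1]].
  - split.
    + simpl. rewrite Rmult_0_r, dn_0 by exact Hk. field.
    + rewrite szego_two_step. cbn [fst snd szego Nat.mul P].
      unfold coef_b. simpl INR. rewrite !Rmult_0_r, dn_0 by exact Hk.
      change (szego k w theta (0 + (0 + 0))) with (1, 0).
      cbn [fst pow]. pose proof (D (2 * w * 1)). field. lra.
  - split; [exact IH1|].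
    rewrite szego_two_step. cbn [fst snd].
    change (P k w (S (S n)) (cos theta))
      with ((cos theta - coef_b k w (S n)) * P k w (S n) (cos theta)
            - coef_u k w (S n) * P k w n (cos theta)).
    rewrite IH1, IH0, szego_two_step. cbn [fst snd]. clear IH0 IH1.
    unfold coef_b, coef_u.
    replace (w * (2 * INR (S n) - 1)) with (w * (2 * INR n + 1)) by (rewrite S_INR; ring).
    replace (2 * w * (INR (S n) - 1)) with (2 * w * INR n) by (rewrite S_INR; ring).
    replace (sn k (w * (2 * INR n + 1)) ^ 2) with (1 - cn k (w * (2 * INR n + 1)) ^ 2)
      by (rewrite cn2; ring).
    pose proof (D (2 * w * INR n)) as D0. pose proof (D (2 * w * INR (S n))) as D1.
    pose proof (D (2 * w * INR (S (S n)))) as D2.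
    pose proof (sin2_cos2 theta) as T. unfold Rsqr in T.
    assert (T' : sin theta ^ 2 = 1 - cos theta ^ 2) by lra. clear T.
    generalize dependent (dn k (2 * w * INR n)). generalize dependent (dn k (2 * w * INR (S n))).
    generalize dependent (dn k (2 * w * INR (S (S n)))).
    generalize (cn k (w * (2 * INR n + 1))) (cn k (w * (2 * INR (S n) + 1))).
    destruct (szego k w theta (2 * n)) as [a b]. cbn [fst snd].
    revert T'. generalize (cos theta) (sin theta).
    intros x s T' g g' d2 H2 d1 H1 d0 H0. cbn [pow].
    generalize ((/ 2) ^ n). intros r.
    field_simplify_eq; [ring [T'] | lra].
Qed.

(** * The explicit expression *)

(** The real zeros of sn are the multiples of 2K, and w/K is irrational. *)
Lemma sn_lattice_neq_0 (k w : R) (n : nat) :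
  0 < k < 1 -> irrational (w / ellK k) -> sn k (w * (INR n + 1)) <> 0.
Proof.
  intros Hk Hw H. pose proof (ellK_pos k Hk) as HK.
  destruct (sn_zero k _ Hk H) as [m Hm]. apply Hw.
  exists (Qmake (2 * m) (Pos.of_succ_nat n)).
  change (w / ellK k = IZR (2 * m) * / IZR (Z.pos (Pos.of_succ_nat n))).
  replace (IZR (Z.pos (Pos.of_succ_nat n))) with (INR n + 1).
  2:{ rewrite <- S_INR, INR_IZR_INZ. f_equal. }
  rewrite mult_IZR. pose proof (pos_INR n).
  apply (Rmult_eq_reg_r ((INR n + 1) * ellK k)); [|nra].
  transitivity (w * (INR n + 1)); [field; lra|]. rewrite Hm. field. lra.
Qed.

Definition sn_factorial (k w : R) (n : nat) : R :=
  prod_lt (fun s => sn k (w * (INR s + 1))) n.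

Lemma sn_factorial_neq_0 (k w : R) (n : nat) :
  0 < k < 1 -> irrational (w / ellK k) -> sn_factorial k w n <> 0.
Proof.
  intros Hk Hw. induction n as [|n IH]; [exact R1_neq_R0|].
  apply Rmult_integral_contrapositive. split; [exact IH | now apply sn_lattice_neq_0].
Qed.

Lemma ellbinom_factorial (k w : R) (i j : nat) :
  0 < k < 1 -> irrational (w / ellK k) ->
  ellbinom k w (i + j) j = sn_factorial k w (i + j) / (sn_factorial k w i * sn_factorial k w j).
Proof.
  intros Hk Hw. unfold ellbinom.
  replace (j <=? i + j)%nat with true by (symmetry; apply Nat.leb_le; lia).
  set (N := (i + j)%nat).
  enough (G : forall l m, (l + m = N)%nat ->
    prod_lt (fun s => sn k (w * (INR N - INR s)) / sn k (w * (INR s + 1))) m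
    = sn_factorial k w N / (sn_factorial k w l * sn_factorial k w m))
    by (apply G; reflexivity).
  intros l m. revert l. induction m as [|m IH]; intros l E.
  - rewrite Nat.add_0_r in E. subst l. simpl.
    change (sn_factorial k w 0) with 1. field. now apply sn_factorial_neq_0.
  - simpl. rewrite (IH (S l)) by lia.
    change (sn_factorial k w (S l)) with (sn_factorial k w l * sn k (w * (INR l + 1))).
    change (sn_factorial k w (S m)) with (sn_factorial k w m * sn k (w * (INR m + 1))).
    replace (INR N - INR m) with (INR l + 1) by (rewrite <- E, plus_INR, S_INR; ring).
    field. repeat split; try (now apply sn_factorial_neq_0); now apply sn_lattice_neq_0.
Qed.

Lemma ellbinom_out (k w : R) (n : nat) : ellbinom k w n (S n) = 0.
Proof.
  unfold ellbinom. replace (S n <=? n)%nat with false; [reflexivity|].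
  symmetry. apply Nat.leb_gt. lia.
Qed.

Lemma ellbinom_full (k w : R) (n : nat) :
  0 < k < 1 -> irrational (w / ellK k) -> ellbinom k w n n = 1.
Proof.
  intros Hk Hw. pose proof (ellbinom_factorial k w 0 n Hk Hw) as E.
  simpl Nat.add in E. rewrite E. change (sn_factorial k w 0) with 1. field.
  now apply sn_factorial_neq_0.
Qed.

Lemma ellbinom_sym (k w : R) (i j : nat) :
  0 < k < 1 -> irrational (w / ellK k) ->
  ellbinom k w (i + j) i = ellbinom k w (i + j) j.
Proof.
  intros Hk Hw. rewrite (ellbinom_factorial k w i j) by assumption.
  rewrite (Nat.add_comm i j), (ellbinom_factorial k w j i) by assumption.
  f_equal. ring.
Qed.

(** Coefficient of z^{n-j} in Phi_n. *)
Definition szego_coef (k w : R) (n j : nat) : R :=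
  (-1) ^ j * ellbinom k w n j * dn_or_cn k n (w * INR j).

(** The two addition identities [sn_add_mul_cn] and [sn_add_mul_dn], one for each
    parity of n. *)
Lemma dn_or_cn_add (k x y : R) (n : nat) : 0 < k < 1 ->
  sn k (x + y) * dn_or_cn k (S n) y
  = sn k x * dn_or_cn k n y + dn_or_cn k (S n) (x + y) * sn k y * dn_or_cn k n x.
Proof.
  intros Hk. unfold dn_or_cn. rewrite Nat.even_succ, <- Nat.negb_even.
  destruct (Nat.even n); cbv iota beta delta [negb].
  - now apply sn_add_mul_cn.
  - now apply sn_add_mul_dn.
Qed.

Lemma dn_or_cn_0 (k : R) (n : nat) : 0 < k < 1 -> dn_or_cn k n 0 = 1.
Proof.
  intros Hk. unfold dn_or_cn. destruct (Nat.even n); [now apply dn_0 | now apply cn_0].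
Qed.

Lemma neg1_sq (n : nat) : (-1) ^ n * (-1) ^ n = 1.
Proof. rewrite <- pow_add. replace (n + n)%nat with (2 * n)%nat by lia. apply pow_1_even. Qed.

(** After division by the common sn-factorials this is [dn_or_cn_add] with x =
    w(n+1-j) and y = wj. At j = 0 and j = n+1 one of the binomials vanishes. *)
Lemma szego_coef_rec (k w : R) (n j : nat) :
  0 < k < 1 -> irrational (w / ellK k) -> (j <= S n)%nat ->
  szego_coef k w (S n) j = szego_coef k w n j - verblunsky k w n * szego_coef k w n (S n - j).
Proof.
  intros Hk Hw Hj.
  assert (A0 : forall m, szego_coef k w m 0 = 1).
  { intros m. unfold szego_coef, ellbinom. simpl. rewrite Rmult_0_r, dn_or_cn_0 by exact Hk. ring. }
  assert (A1 : szego_coef k w n (S n) = 0).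
  { unfold szego_coef. rewrite ellbinom_out. ring. }
  destruct j as [|i].
  - rewrite Nat.sub_0_r, !A0, A1. ring.
  - destruct (Nat.eq_dec i n) as [->|Hi].
    + rewrite Nat.sub_diag, A0, A1. unfold szego_coef, verblunsky.
      rewrite ellbinom_full, S_INR by assumption. simpl pow. ring.
    + destruct (Nat.le_exists_sub (S i) n) as [m [E _]]; [lia|].
      replace (S n - S i)%nat with (S m) by lia.
      unfold szego_coef, verblunsky.
      pose proof (dn_or_cn_add k (w * (INR m + 1)) (w * (INR i + 1)) n Hk) as Add.
      replace (w * (INR m + 1) + w * (INR i + 1)) with (w * (INR n + 1)) in Add
        by (rewrite E, plus_INR, S_INR; ring).
      pose proof (ellbinom_factorial k w (S m) (S i) Hk Hw) as B1.
      replace (S m + S i)%nat with (S n) in B1 by lia.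
      pose proof (ellbinom_factorial k w m (S i) Hk Hw) as B2.
      rewrite <- E in B2.
      pose proof (ellbinom_factorial k w i (S m) Hk Hw) as B3.
      replace (i + S m)%nat with n in B3 by lia.
      rewrite B1, B2, B3, !S_INR.
      replace ((-1) ^ n) with ((-1) ^ m * (-1) ^ S i) by (rewrite <- pow_add; f_equal; lia).
      change ((-1) ^ S m) with (-1 * (-1) ^ m).
      replace ((-1) ^ m * (-1) ^ S i * dn_or_cn k (S n) (w * (INR n + 1)) *
        (-1 * (-1) ^ m * (sn_factorial k w n / (sn_factorial k w i * sn_factorial k w (S m)))
          * dn_or_cn k n (w * (INR m + 1))))
        with (- ((-1) ^ m * (-1) ^ m) * (-1) ^ S i * dn_or_cn k (S n) (w * (INR n + 1)) *
        ((sn_factorial k w n / (sn_factorial k w i * sn_factorial k w (S m)))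
          * dn_or_cn k n (w * (INR m + 1)))) by ring.
      rewrite neg1_sq.
      assert (FS : forall l, sn_factorial k w (S l) = sn_factorial k w l * sn k (w * (INR l + 1)))
        by reflexivity.
      rewrite !FS.
      pose proof (sn_factorial_neq_0 k w i Hk Hw). pose proof (sn_factorial_neq_0 k w m Hk Hw).
      pose proof (sn_lattice_neq_0 k w i Hk Hw). pose proof (sn_lattice_neq_0 k w m Hk Hw).
      transitivity ((-1) ^ S i * sn_factorial k w n
        * (sn k (w * (INR n + 1)) * dn_or_cn k (S n) (w * (INR i + 1)))
        / (sn_factorial k w m * sn k (w * (INR m + 1))
           * (sn_factorial k w i * sn k (w * (INR i + 1))))).
      * field. repeat split; assumption.
      * rewrite Add. field. repeat split; assumption.
Qed.

Lemma sum_n_lin (f g : nat -> R) (a b : R) (n : nat) :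
  sum_n (fun j => a * f j + b * g j) n = a * sum_n f n + b * sum_n g n.
Proof.
  induction n as [|n IH]; [now rewrite !sum_O|].
  rewrite !sum_Sn, IH. change plus with Rplus.
  as_real. ring.
Qed.

Lemma sum_n_rev (f : nat -> R) (n : nat) : sum_n (fun j => f (n - j)%nat) n = sum_n f n.
Proof.
  revert f. induction n as [|n IH]; intros f; [now rewrite !sum_O|].
  rewrite sum_Sn, Nat.sub_diag.
  rewrite (sum_n_ext_loc _ (fun j => f (S (n - j)))) by (intros j Hj; f_equal; lia).
  rewrite (IH (fun j => f (S j))). unfold sum_n.
  rewrite (sum_Sn_m f 0 (S n)), <- sum_n_m_S by lia. change plus with Rplus.
  as_real. ring.
Qed.

(** In the variable z the recurrence acts on coefficients by [szego_coef_rec];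
    reversal of the order of the coefficients is complex conjugation, hence changes
    the sign of the sines only. *)
Lemma szego_explicit (k w theta : R) (n : nat) :
  0 < k < 1 -> irrational (w / ellK k) ->
  szego k w theta n
  = (sum_n (fun j => szego_coef k w n j * cos ((INR n / 2 - INR j) * theta)) n,
     sum_n (fun j => szego_coef k w n j * sin ((INR n / 2 - INR j) * theta)) n).
Proof.
  intros Hk Hw. induction n as [|n IH].
  - rewrite !sum_O. unfold szego_coef, ellbinom. simpl.
    rewrite Rmult_0_r, dn_or_cn_0 by exact Hk.
    replace ((0 / 2 - 0) * theta) with 0 by field. rewrite cos_0, sin_0.
    f_equal; ring.
  - cbn [szego]. rewrite IH. cbn [fst snd]. clear IH.
    set (v := verblunsky k w n).
    set (C := fun j => cos ((INR (S n) / 2 - INR j) * theta)).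
    set (Z := fun j => sin ((INR (S n) / 2 - INR j) * theta)).
    assert (RC : forall j, (j <= S n)%nat -> C (S n - j)%nat = C j).
    { intros j Hj. unfold C. rewrite minus_INR by exact Hj. rewrite <- cos_neg. f_equal. field. }
    assert (RZ : forall j, (j <= S n)%nat -> Z (S n - j)%nat = - Z j).
    { intros j Hj. unfold Z. rewrite minus_INR by exact Hj. rewrite <- sin_neg. f_equal. field. }
    assert (Drop : forall f : nat -> R, sum_n (fun j => szego_coef k w n j * f j) (S n)
              = sum_n (fun j => szego_coef k w n j * f j) n).
    { intros f. rewrite sum_Sn. unfold szego_coef at 2. rewrite ellbinom_out.
      change plus with Rplus. as_real. ring. }
    assert (Fold : forall f : nat -> R, sum_n (fun j => szego_coef k w (S n) j * f j) (S n)
              = sum_n (fun j => szego_coef k w n j * f j) n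
                - v * sum_n (fun j => szego_coef k w n j * f (S n - j)%nat) n).
    { intros f.
      rewrite (sum_n_ext_loc _ (fun j => 1 * (szego_coef k w n j * f j)
                 + (- v) * (szego_coef k w n (S n - j) * f j))).
      2:{ intros j Hj. rewrite szego_coef_rec by assumption. fold v.
          as_real. ring. }
      rewrite sum_n_lin, Drop.
      rewrite <- (sum_n_rev (fun j => szego_coef k w n (S n - j) * f j)).
      rewrite (sum_n_ext_loc (fun j => szego_coef k w n (S n - (S n - j)) * f (S n - j)%nat)
                 (fun j => szego_coef k w n j * f (S n - j)%nat)).
      2:{ intros j Hj. do 2 f_equal. lia. }
      rewrite (Drop (fun j => f (S n - j)%nat)).
      as_real. ring. }
    assert (EC : sum_n (fun j => szego_coef k w n j * C j) n
       = cos (theta / 2) * sum_n (fun j => szego_coef k w n j * cos ((INR n / 2 - INR j) * theta)) n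
         + - sin (theta / 2) * sum_n (fun j => szego_coef k w n j * sin ((INR n / 2 - INR j) * theta)) n).
    { rewrite <- sum_n_lin. apply sum_n_ext. intros j. unfold C.
      replace ((INR (S n) / 2 - INR j) * theta) with (theta / 2 + (INR n / 2 - INR j) * theta)
        by (rewrite S_INR; field).
      rewrite cos_plus. as_real. ring. }
    assert (EZ : sum_n (fun j => szego_coef k w n j * Z j) n
       = sin (theta / 2) * sum_n (fun j => szego_coef k w n j * cos ((INR n / 2 - INR j) * theta)) n
         + cos (theta / 2) * sum_n (fun j => szego_coef k w n j * sin ((INR n / 2 - INR j) * theta)) n).
    { rewrite <- sum_n_lin. apply sum_n_ext. intros j. unfold Z.
      replace ((INR (S n) / 2 - INR j) * theta) with (theta / 2 + (INR n / 2 - INR j) * theta)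
        by (rewrite S_INR; field).
      rewrite sin_plus. as_real. ring. }
    match goal with |- ?l = _ =>
      change (l = (sum_n (fun j => szego_coef k w (S n) j * C j) (S n),
                   sum_n (fun j => szego_coef k w (S n) j * Z j) (S n))) end.
    rewrite (Fold C), (Fold Z).
    rewrite (sum_n_ext_loc (fun j => szego_coef k w n j * C (S n - j)%nat)
               (fun j => szego_coef k w n j * C j)) by (intros j Hj; rewrite RC by lia; reflexivity).
    rewrite (sum_n_ext_loc (fun j => szego_coef k w n j * Z (S n - j)%nat)
               (fun j => (-1) * (szego_coef k w n j * Z j) + 0 * (szego_coef k w n j * Z j))).
    2:{ intros j Hj. rewrite RZ by lia. as_real. ring. }
    rewrite sum_n_lin, EC, EZ.
    apply (f_equal2 pair); as_real; ring.
Qed.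

Lemma sum_n_fold (f : nat -> R) (n : nat) :
  sum_n f (2 * n) = f n + sum_n_m (fun s => f (n - s)%nat + f (n + s)%nat) 1 n.
Proof.
  enough (G : forall m, (m <= n)%nat ->
    sum_n_m f (n - m) (n + m) = f n + sum_n_m (fun s => f (n - s)%nat + f (n + s)%nat) 1 m).
  { specialize (G n (le_n n)). rewrite Nat.sub_diag in G.
    replace (2 * n)%nat with (n + n)%nat by lia. exact G. }
  induction m as [|m IH]; intros Hm.
  - rewrite Nat.sub_0_r, Nat.add_0_r, sum_n_n, sum_n_m_zero by lia.
    change zero with 0. as_real. ring.
  - rewrite (sum_n_Sm _ 1 m) by lia. rewrite sum_Sn_m by lia.
    replace (S (n - S m)) with (n - m)%nat by lia.
    replace (n + S m)%nat with (S (n + m)) by lia.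
    rewrite sum_n_Sm, IH by lia. change plus with Rplus.
    as_real. ring.
Qed.

Lemma powerRZ_two (n : nat) : powerRZ 2 (1 - Z.of_nat n) = 2 * (/ 2) ^ n.
Proof.
  unfold Z.sub. rewrite powerRZ_add by lra. rewrite powerRZ_1. f_equal.
  rewrite powerRZ_neg', <- pow_powerRZ. symmetry. apply pow_inv.
Qed.

Definition explicit_P (k w : R) (n : nat) (x : R) : R :=
  (-1) ^ n * powerRZ 2 (1 - Z.of_nat n) / (1 + dn k (2 * w * INR n))
     * (dn k (w * INR n) * ellbinom k w (2 * n) n
        + sum_n_m (fun s : nat =>
            (-1) ^ s * ellbinom k w (2 * n) (n + s)
            * (dn k (w * (INR n - INR s)) + dn k (w * (INR n + INR s)))
            * Cheb s x) 1 n).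

(** The terms j = n - s and j = n + s have the same cosine, and equal elliptic
    binomials by symmetry. *)
Lemma explicit_P_cos (k w theta : R) (n : nat) :
  0 < k < 1 -> irrational (w / ellK k) ->
  P k w n (cos theta) = explicit_P k w n (cos theta).
Proof.
  intros Hk Hw. rewrite P_szego, szego_explicit by assumption. cbn [fst].
  unfold explicit_P. rewrite powerRZ_two.
  rewrite sum_n_fold.
  set (T := fun s : nat => (-1) ^ s * ellbinom k w (2 * n) (n + s)
            * (dn k (w * (INR n - INR s)) + dn k (w * (INR n + INR s))) * Cheb s (cos theta)).
  assert (Even : Nat.even (2 * n) = true) by apply Nat.even_even.
  assert (E0 : szego_coef k w (2 * n) n * cos ((INR (2 * n) / 2 - INR n) * theta)
               = (-1) ^ n * (dn k (w * INR n) * ellbinom k w (2 * n) n)).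
  { unfold szego_coef, dn_or_cn. rewrite Even.
    replace ((INR (2 * n) / 2 - INR n) * theta) with 0
      by (rewrite mult_INR; simpl INR; field).
    rewrite cos_0. ring. }
  rewrite E0.
  assert (E1 : sum_n_m (fun s =>
      szego_coef k w (2 * n) (n - s) * cos ((INR (2 * n) / 2 - INR (n - s)) * theta) +
      szego_coef k w (2 * n) (n + s) * cos ((INR (2 * n) / 2 - INR (n + s)) * theta)) 1 n
      = (-1) ^ n * sum_n_m T 1 n).
  { refine (eq_trans _ (sum_n_m_mult_l (K := R_Ring) ((-1) ^ n) T 1 n)).
    apply sum_n_m_ext_loc. intros s Hs. unfold T, szego_coef, dn_or_cn. rewrite Even.
    change (mult ?p ?q) with (Rmult p q).
    rewrite Cheb_cos.
    replace ((INR (2 * n) / 2 - INR (n - s)) * theta) with (INR s * theta)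
      by (rewrite minus_INR, mult_INR by lia; simpl INR; field).
    replace ((INR (2 * n) / 2 - INR (n + s)) * theta) with (- (INR s * theta))
      by (rewrite plus_INR, mult_INR; simpl INR; field).
    rewrite cos_neg.
    replace (ellbinom k w (2 * n) (n - s)) with (ellbinom k w (2 * n) (n + s)).
    2:{ pose proof (ellbinom_sym k w (n + s) (n - s) Hk Hw) as E.
        now replace (n + s + (n - s))%nat with (2 * n)%nat in E by lia. }
    rewrite minus_INR, plus_INR by lia.
    replace ((-1) ^ (n - s)) with ((-1) ^ n * (-1) ^ s).
    2:{ replace n with (n - s + s)%nat at 1 by lia. rewrite pow_add, Rmult_assoc, neg1_sq. ring. }
    rewrite pow_add. as_real. ring. }
  rewrite E1. pose proof (dn_pos k (2 * w * INR n) Hk).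
  as_real. field. lra.
Qed.

(** Polynomial functions of degree at most [n], defined by their divided
    differences; this makes the count of zeros in [poly_fun_zero] an immediate
    induction. *)
Fixpoint poly_fun (n : nat) (f : R -> R) : Prop :=
  match n with
  | O => forall x y, f x = f y
  | S m => forall c, exists g, poly_fun m g /\ forall x, f x = f c + (x - c) * g x
  end.

Lemma poly_fun_ext (n : nat) (f g : R -> R) :
  (forall x, f x = g x) -> poly_fun n f -> poly_fun n g.
Proof.
  destruct n as [|n]; simpl; intros E H.
  - intros x y. now rewrite <- !E.
  - intros c. destruct (H c) as [h [Ph Eh]]. exists h. split; [exact Ph|].
    intros x. rewrite <- !E. apply Eh.
Qed.

Lemma poly_fun_weaken (n : nat) (f : R -> R) : poly_fun n f -> poly_fun (S n) f.
Proof.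
  revert f. induction n as [|n IH]; intros f H c.
  - exists (fun _ => 0). split; [intros ? ?; reflexivity|].
    intros x. rewrite (H x c). ring.
  - destruct (H c) as [g [Pg Eg]]. exists g. split; [now apply IH | exact Eg].
Qed.

Lemma poly_fun_le (n m : nat) (f : R -> R) : (n <= m)%nat -> poly_fun n f -> poly_fun m f.
Proof. intros H. induction H; [auto|]. intros. apply poly_fun_weaken. auto. Qed.

Lemma poly_fun_lin (n : nat) (f g : R -> R) (a b : R) :
  poly_fun n f -> poly_fun n g -> poly_fun n (fun x => a * f x + b * g x).
Proof.
  revert f g. induction n as [|n IH]; simpl; intros f g Hf Hg.
  - intros x y. now rewrite (Hf x y), (Hg x y).
  - intros c. destruct (Hf c) as [f1 [P1 E1]]. destruct (Hg c) as [g1 [Q1 F1]].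
    exists (fun x => a * f1 x + b * g1 x). split; [now apply IH|].
    intros x. rewrite (E1 x), (F1 x). ring.
Qed.

Lemma poly_fun_const (n : nat) (a : R) : poly_fun n (fun _ => a).
Proof. apply (poly_fun_le 0); [lia|]. intros ? ?; reflexivity. Qed.

Lemma poly_fun_shift (n : nat) (f : R -> R) : poly_fun n f -> poly_fun (S n) (fun x => x * f x).
Proof.
  revert f. induction n as [|n IH]; intros f H c.
  - exists (fun _ => f c). split; [intros ? ?; reflexivity|].
    intros x. rewrite (H x c). ring.
  - destruct (H c) as [g [Pg Eg]]. exists (fun x => f c * 1 + 1 * (x * g x)). split.
    + apply (poly_fun_lin _ (fun _ => 1) (fun x => x * g x) (f c) 1);
        [apply poly_fun_const | now apply IH].
    + intros x. rewrite (Eg x). ring.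
Qed.

Lemma poly_fun_zero (n : nat) (f : R -> R) (a b : R) :
  a < b -> poly_fun n f -> (forall y, a < y < b -> f y = 0) -> forall x, f x = 0.
Proof.
  revert f a. induction n as [|n IH]; intros f a Hab Hf H0 x.
  - rewrite (Hf x ((a + b) / 2)). apply H0. lra.
  (* The quotient by x - c vanishes on the right half of the interval. *)
  - set (c := (a + b) / 2). destruct (Hf c) as [g [Pg Eg]].
    assert (Fc : f c = 0) by (apply H0; unfold c; lra).
    rewrite Eg, Fc, (IH g c); [ring | unfold c; lra | exact Pg |].
    intros y Hy. assert (Fy : f y = 0) by (apply H0; unfold c in Hy; lra).
    rewrite Eg, Fc in Fy. apply (Rmult_eq_reg_l (y - c)); lra.
Qed.

Lemma poly_fun_Cheb (s : nat) : poly_fun s (Cheb s).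
Proof.
  enough (poly_fun s (Cheb s) /\ poly_fun (S s) (Cheb (S s))) by tauto.
  induction s as [|s [H0 H1]].
  - split; [intros ? ?; reflexivity|].
    apply (poly_fun_ext _ (fun x => x * 1)); [intros x; simpl; ring|].
    apply poly_fun_shift. intros ? ?; reflexivity.
  - split; [exact H1|].
    apply (poly_fun_ext _ (fun x => 2 * (x * Cheb (S s) x) + (-1) * Cheb s x)).
    + intros x. simpl. ring.
    + apply (poly_fun_lin _ (fun x => x * Cheb (S s) x)); [now apply poly_fun_shift|].
      apply (poly_fun_le s); [lia | exact H0].
Qed.

Lemma poly_fun_P (k w : R) (n : nat) : poly_fun n (P k w n).
Proof.
  enough (poly_fun n (P k w n) /\ poly_fun (S n) (P k w (S n))) by tauto.
  induction n as [|n [H0 H1]].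
  - split; [intros ? ?; reflexivity|].
    apply (poly_fun_ext _ (fun x => 1 * (x * 1) + (- coef_b k w 0) * 1)); [intros x; simpl; ring|].
    apply (poly_fun_lin _ (fun x => x * 1) (fun _ => 1)); [|apply poly_fun_const].
    apply poly_fun_shift. intros ? ?; reflexivity.
  - split; [exact H1|].
    apply (poly_fun_ext _ (fun x => 1 * (1 * (x * P k w (S n) x) + (- coef_b k w (S n)) * P k w (S n) x)
                            + (- coef_u k w (S n)) * P k w n x)).
    + intros x. simpl. ring.
    + apply (poly_fun_lin _ (fun x => 1 * (x * P k w (S n) x) + (- coef_b k w (S n)) * P k w (S n) x)).
      * apply (poly_fun_lin _ (fun x => x * P k w (S n) x)); [now apply poly_fun_shift|].
        now apply poly_fun_weaken.
      * apply (poly_fun_le n); [lia | exact H0].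
Qed.

Lemma poly_fun_sum (N : nat) (c : nat -> R) (f : nat -> R -> R) (n : nat) :
  (n <= N)%nat -> (forall s, (s <= n)%nat -> poly_fun N (f s)) ->
  poly_fun N (fun x => sum_n_m (fun s => c s * f s x) 1 n).
Proof.
  intros Hn. induction n as [|n IH]; intros Hf.
  - apply (poly_fun_ext _ (fun _ => 0)); [|apply poly_fun_const].
    intros x. now rewrite sum_n_m_zero by lia.
  - apply (poly_fun_ext _ (fun x => 1 * sum_n_m (fun s => c s * f s x) 1 n + c (S n) * f (S n) x)).
    + intros x. rewrite (sum_n_Sm _ 1 n) by lia. change plus with Rplus.
      as_real. ring.
    + apply (poly_fun_lin _ (fun x => sum_n_m (fun s => c s * f s x) 1 n)).
      * apply IH; [lia|]. intros s Hs. apply Hf. lia.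
      * apply Hf. lia.
Qed.

(** Both sides are polynomials that agree on [-1,1], where x = cos(acos x). *)
Lemma P_explicit (k w : R) (n : nat) (x : R) :
  0 < k < 1 -> irrational (w / ellK k) -> P k w n x = explicit_P k w n x.
Proof.
  intros Hk Hw.
  enough (H : 1 * P k w n x + (-1) * explicit_P k w n x = 0) by lra.
  revert x. apply (poly_fun_zero n (fun x => 1 * P k w n x + (-1) * explicit_P k w n x) (-1) 1);
    [lra| |].
  - apply poly_fun_lin; [apply poly_fun_P|]. unfold explicit_P.
    set (A := (-1) ^ n * powerRZ 2 (1 - Z.of_nat n) / (1 + dn k (2 * w * INR n))).
    set (B := dn k (w * INR n) * ellbinom k w (2 * n) n).
    apply (poly_fun_ext _ (fun x => A * B + A * sum_n_m (fun s : nat =>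
            ((-1) ^ s * ellbinom k w (2 * n) (n + s)
            * (dn k (w * (INR n - INR s)) + dn k (w * (INR n + INR s))))
            * Cheb s x) 1 n)); [intros; ring|].
    apply (poly_fun_lin _ (fun _ => B)); [apply poly_fun_const|].
    apply poly_fun_sum; [lia|]. intros s Hs. apply (poly_fun_le s); [lia | apply poly_fun_Cheb].
  - intros y Hy. rewrite <- (cos_acos y) by lra. rewrite explicit_P_cos by assumption. ring.
Qed.

(** * Orthogonality *)

Lemma prod_lt_head (f : nat -> R) (n : nat) :
  prod_lt f (S n) = f O * prod_lt (fun i => f (S i)) n.
Proof.
  induction n as [|n IH]; [simpl; ring|].
  change (prod_lt f (S (S n))) with (prod_lt f (S n) * f (S n)). rewrite IH. simpl. ring.
Qed.

Lemma prod_lt_ext (f g : nat -> R) (n : nat) :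
  (forall i, f i = g i) -> prod_lt f n = prod_lt g n.
Proof. intros E. induction n as [|n IH]; [reflexivity|]. simpl. now rewrite IH, E. Qed.

Lemma prod_lt_zero (f : nat -> R) (n i : nat) : (i < n)%nat -> f i = 0 -> prod_lt f n = 0.
Proof.
  intros Hi H0. induction n as [|n IH]; [lia|]. simpl.
  destruct (Nat.eq_dec i n) as [<-|]; [rewrite H0; ring | rewrite IH by lia; ring].
Qed.

Lemma prod_sn_reflect (k w tau : R) (n : nat) : 0 < k < 1 ->
  prod_lt (fun i => sn k (w * (- tau - INR n + INR i))) n
  = (-1) ^ n * prod_lt (fun i => sn k (w * (tau + 1 + INR i))) n.
Proof.
  intros Hk. revert tau. induction n as [|n IH]; intros tau; [simpl; ring|].
  rewrite prod_lt_head with (f := fun i => sn k (w * (tau + 1 + INR i))).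
  change (prod_lt ?f (S n)) with (prod_lt f n * f n). cbv beta.
  rewrite (prod_lt_ext _ (fun i => sn k (w * (- (tau + 1) - INR n + INR i)))).
  2:{ intros i. do 2 f_equal. rewrite S_INR. ring. }
  rewrite IH.
  rewrite (prod_lt_ext (fun i => sn k (w * (tau + 1 + 1 + INR i)))
            (fun i => sn k (w * (tau + 1 + INR (S i)))))
    by (intros i; do 2 f_equal; rewrite S_INR; ring).
  replace (w * (- tau - INR (S n) + INR n)) with (- (w * (tau + 1 + INR 0)))
    by (rewrite S_INR; simpl INR; ring).
  rewrite sn_opp by exact Hk. simpl pow. ring.
Qed.

(** The mixed addition theorems [cn_add_dn] and [dn_add_cn], one for each parity of
    n. *)
Lemma dn_or_cn_mul (k x y : R) (n : nat) : 0 < k < 1 ->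
  dn_or_cn k (S n) (x + y) - dn_or_cn k (S n) x * dn_or_cn k (S n) y
  = (if Nat.even n then -1 else - k ^ 2) * sn k x * sn k y * dn_or_cn k n (x + y).
Proof.
  intros Hk. unfold dn_or_cn. rewrite Nat.even_succ, <- Nat.negb_even.
  destruct (Nat.even n); cbv iota beta delta [negb].
  - pose proof (cn_add_dn k x y Hk). lra.
  - pose proof (dn_add_cn k x y Hk). lra.
Qed.

(** The angle theta with [node] equal to cos(theta). *)
Definition angle (k w : R) (s : Z) : R := PI * w * (IZR s - / 2) / ellK k.

(** Contribution of one spectral point to the real part of the integral of z^tau
    Phi_n(z), for any real exponent tau. *)
Definition szego_moment (k w : R) (n : nat) (tau : R) (s : Z) : R :=
  weight k s * (fst (szego k w (angle k w s) n) * cos ((tau + INR n / 2) * angle k w s)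
                - snd (szego k w (angle k w s) n) * sin ((tau + INR n / 2) * angle k w s)).

Lemma szego_moment_rec (k w tau : R) (n : nat) (s : Z) :
  szego_moment k w (S n) tau s
  = 1 * szego_moment k w n (tau + 1) s
    + (- verblunsky k w n) * szego_moment k w n (- tau - INR n) s.
Proof.
  unfold szego_moment. set (th := angle k w s). cbn [szego fst snd].
  set (phi := (tau + INR (S n) / 2) * th).
  replace ((tau + 1 + INR n / 2) * th) with (phi + th / 2)
    by (unfold phi; rewrite S_INR; field).
  replace ((- tau - INR n + INR n / 2) * th) with (- (phi - th / 2))
    by (unfold phi; rewrite S_INR; field).
  rewrite cos_neg, sin_neg, cos_plus, cos_minus, sin_plus, sin_minus. ring.
Qed.

(** By [szego_moment_rec] the moments of Phi_{n+1} combine those of Phi_n at tau + 1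
    and at - tau - n. The two products of sn coincide up to sign, and the difference
    of the remaining factors is sn(w tau) times a constant by [dn_or_cn_mul], which
    supplies the new factor of the product and changes cn into dn or conversely. *)
Lemma szego_moment_product (k w : R) (n : nat) : 0 < k < 1 ->
  exists c, forall tau, is_bilateral_series (szego_moment k w n tau)
    (c * dn_or_cn k (S n) (w * (tau + INR n))
       * prod_lt (fun i => sn k (w * (tau + INR i))) n).
Proof.
  intros Hk. induction n as [|n [c IH]].
  - exists 1. intros tau.
    refine (bilateral_ext _ _ _ _ _ _ (cn_bilateral k (w * tau) Hk)).
    + intros s. unfold szego_moment, angle. cbn [szego fst snd]. simpl INR.
      replace ((tau + 0 / 2) * (PI * w * (IZR s - / 2) / ellK k))
        with (PI * (w * tau) * (IZR s - / 2) / ellK k) by (unfold Rdiv; ring).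
      ring.
    + simpl INR. rewrite Rplus_0_r. unfold dn_or_cn. simpl. ring.
  - exists (c * (if Nat.even n then -1 else - k ^ 2) * sn k (w * (INR n + 1))).
    intros tau.
    refine (bilateral_ext _ _ _ _ _ _ (bilateral_lin _ _ _ _ 1 (- verblunsky k w n)
              (IH (tau + 1)) (IH (- tau - INR n)))).
    + intros s. symmetry. apply szego_moment_rec.
    + rewrite prod_sn_reflect, prod_lt_head by exact Hk.
      rewrite (prod_lt_ext (fun i => sn k (w * (tau + INR (S i))))
                (fun i => sn k (w * (tau + 1 + INR i))))
        by (intros i; do 2 f_equal; rewrite S_INR; ring).
      set (Q := prod_lt _ n). unfold verblunsky.
      replace (w * (- tau - INR n + INR n)) with (- (w * tau)) by ring.
      assert (Ev : dn_or_cn k (S n) (- (w * tau)) = dn_or_cn k (S n) (w * tau)).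
      { unfold dn_or_cn. destruct (Nat.even (S n)); [now apply dn_opp | now apply cn_opp]. }
      rewrite Ev.
      pose proof (dn_or_cn_mul k (w * tau) (w * (INR n + 1)) n Hk) as M.
      replace (w * tau + w * (INR n + 1)) with (w * (tau + 1 + INR n)) in M by ring.
      replace (w * (tau + INR (S n))) with (w * (tau + 1 + INR n)) by (rewrite S_INR; ring).
      change (dn_or_cn k (S (S n))) with (dn_or_cn k n).
      change (INR 0) with 0. rewrite Rplus_0_r.
      transitivity (c * (dn_or_cn k (S n) (w * (tau + 1 + INR n)) -
        ((-1) ^ n * (-1) ^ n) * (dn_or_cn k (S n) (w * tau) * dn_or_cn k (S n) (w * (INR n + 1)))) * Q);
        [ring|].
      rewrite neg1_sq, Rmult_1_l, M. ring.
Qed.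

(** P_n cos(j theta) is, up to a constant, the sum of the real parts of z^tau
    Phi_{2n} at tau = j - n and tau = - j - n, and both exponents are zeros of the
    product in [szego_moment_product]. *)
Lemma P_cos_moment (k w : R) (n : nat) (j : Z) : 0 < k < 1 ->
  (Z.abs j < Z.of_nat n)%Z ->
  is_bilateral_series
    (fun s => weight k s * P k w n (node k w s) * cos (IZR j * angle k w s)) 0.
Proof.
  intros Hk Hj. destruct (szego_moment_product k w (2 * n) Hk) as [c Hc].
  assert (Z0 : forall i : Z, (Z.abs i < Z.of_nat n)%Z ->
    is_bilateral_series (szego_moment k w (2 * n) (IZR i - INR n)) 0).
  { intros i Hi. refine (bilateral_ext _ _ _ _ _ _ (Hc (IZR i - INR n))); [reflexivity|].
    rewrite (prod_lt_zero _ _ (Z.to_nat (Z.of_nat n - i))); [ring | lia |].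
    replace (w * (IZR i - INR n + INR (Z.to_nat (Z.of_nat n - i)))) with 0.
    - now apply sn_0.
    - rewrite !INR_IZR_INZ, Z2Nat.id, minus_IZR by lia. ring. }
  set (C := 2 * (/ 2) ^ n / (1 + dn k (2 * w * INR n))).
  refine (bilateral_ext _ _ _ _ _ _ (bilateral_lin _ _ _ _ (C / 2) (C / 2)
            (Z0 j Hj) (Z0 (- j)%Z ltac:(lia)))); [|ring].
  intros s. change (node k w s) with (cos (angle k w s)). rewrite P_szego by exact Hk.
  unfold szego_moment. set (th := angle k w s).
  replace ((IZR j - INR n + INR (2 * n) / 2) * th) with (IZR j * th)
    by (rewrite mult_INR; simpl INR; field).
  replace ((IZR (- j) - INR n + INR (2 * n) / 2) * th) with (- (IZR j * th))
    by (rewrite mult_INR, opp_IZR; simpl INR; field).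
  rewrite cos_neg, sin_neg. unfold C.
  pose proof (dn_pos k (2 * w * INR n) Hk). generalize ((/ 2) ^ n). intros r. field. lra.
Qed.

Definition P_prev (k w : R) (m : nat) (x : R) : R :=
  match m with O => 0 | S l => P k w l x end.

Lemma P_S (k w : R) (m : nat) (x : R) :
  P k w (S m) x = (x - coef_b k w m) * P k w m x - coef_u k w m * P_prev k w m x.
Proof. reflexivity. Qed.

(** Induction on m through the recurrence of P_m, since multiplication by x =
    cos(theta) moves j to j + 1 and j - 1. Keeping the factor cos(j theta) makes the
    induction close without an expansion of P_m in Chebyshev polynomials. *)
Lemma P_orthogonal_cos (k w : R) (m n : nat) (j : Z) : 0 < k < 1 ->
  (Z.of_nat m + Z.abs j < Z.of_nat n)%Z ->
  is_bilateral_series (fun s => weight k s * P k w n (node k w s) * P k w m (node k w s)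
                                * cos (IZR j * angle k w s)) 0.
Proof.
  intros Hk. revert n j.
  enough (H : forall n j, (Z.of_nat m + Z.abs j < Z.of_nat n)%Z ->
    is_bilateral_series (fun s => weight k s * P k w n (node k w s) * P k w m (node k w s)
                                * cos (IZR j * angle k w s)) 0 /\
    is_bilateral_series (fun s => weight k s * P k w n (node k w s) * P_prev k w m (node k w s)
                                * cos (IZR j * angle k w s)) 0) by apply H.
  induction m as [|m IH]; intros n j Hj.
  - assert (B := P_cos_moment k w n j Hk ltac:(lia)). split.
    + refine (bilateral_ext _ _ _ _ _ _ B); [|reflexivity]. intros s. simpl. ring.
    + refine (bilateral_ext _ _ _ _ _ _ (bilateral_lin _ _ _ _ 0 0 B B)); [|ring].
      intros s. simpl. ring.
  - split.
    + destruct (IH n (j + 1)%Z ltac:(lia)) as [B1 _].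
      destruct (IH n (j - 1)%Z ltac:(lia)) as [B2 _].
      destruct (IH n j ltac:(lia)) as [B3 B4].
      pose proof (bilateral_lin _ _ _ _ 1 1 (bilateral_lin _ _ _ _ (/ 2) (/ 2) B1 B2)
        (bilateral_lin _ _ _ _ (- coef_b k w m) (- coef_u k w m) B3 B4)) as B.
      refine (bilateral_ext _ _ _ _ _ _ B); [|ring].
      intros s. rewrite P_S. change (node k w s) with (cos (angle k w s)).
      set (th := angle k w s).
      replace (IZR (j + 1) * th) with (IZR j * th + th) by (rewrite plus_IZR; ring).
      replace (IZR (j - 1) * th) with (IZR j * th - th) by (rewrite minus_IZR; ring).
      rewrite cos_plus, cos_minus. field.
    + apply IH. lia.
Qed.

Lemma P_orthogonal (k w : R) (m n : nat) : 0 < k < 1 -> (m < n)%nat ->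
  is_bilateral_series (fun s => weight k s * P k w n (node k w s) * P k w m (node k w s)) 0.
Proof.
  intros Hk Hmn. pose proof (P_orthogonal_cos k w m n 0 Hk ltac:(lia)) as B.
  refine (bilateral_ext _ _ _ _ _ _ B); [|reflexivity].
  intros s. rewrite Rmult_0_l, cos_0. ring.
Qed.

(** The integral of P_{n+1}^2 is that of x P_n P_{n+1}, and expanding x P_{n+1}
    leaves u_{n+1} times the integral of P_n^2; all other terms vanish by
    orthogonality. *)
Lemma P_norm (k w : R) (n : nat) : 0 < k < 1 ->
  is_bilateral_series (fun s => weight k s * P k w n (node k w s) * P k w n (node k w s))
    (Hnorm k w n).
Proof.
  intros Hk. induction n as [|n IH].
  - refine (bilateral_ext _ _ _ _ _ _ (cn_bilateral k 0 Hk)).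
    + intros s. replace (PI * 0 * (IZR s - / 2) / ellK k) with 0 by (unfold Rdiv; ring).
      rewrite cos_0. simpl. ring.
    + rewrite cn_0 by exact Hk. reflexivity.
  - assert (B1 := P_orthogonal k w n (S (S n)) Hk ltac:(lia)).
    assert (B2 := P_orthogonal k w n (S n) Hk ltac:(lia)).
    assert (B3 : is_bilateral_series
      (fun s => weight k s * P k w (S n) (node k w s) * P_prev k w n (node k w s)) 0).
    { destruct n as [|l].
      - refine (bilateral_ext _ _ _ _ _ _ (bilateral_lin _ _ _ _ 0 0 B2 B2)); [|ring].
        intros s. simpl. ring.
      - apply (P_orthogonal k w l); [exact Hk | lia]. }
    pose proof (bilateral_lin _ _ _ _ 1 1
      (bilateral_lin _ _ _ _ 1 (coef_u k w (S n)) B1 IH)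
      (bilateral_lin _ _ _ _ (coef_b k w (S n) - coef_b k w n) (- coef_u k w n) B2 B3)) as B.
    refine (bilateral_ext _ _ _ _ _ _ B).
    + intros s. rewrite (P_S k w (S n)). cbn [P_prev].
      set (x := node k w s).
      transitivity (weight k s * P k w (S n) x * ((x - coef_b k w n) * P k w n x
         - coef_u k w n * P_prev k w n x)); [ring|].
      now rewrite <- P_S.
    + unfold Hnorm. simpl prod_lt. ring.
Qed.

Lemma P_orthogonality (k w : R) (n m : nat) : 0 < k < 1 ->
  is_bilateral_series
    (fun s : Z => weight k s * P k w n (node k w s) * P k w m (node k w s))
    (Hnorm k w n * (if (n =? m)%nat then 1 else 0)).
Proof.
  intros Hk. destruct (Nat.eqb_spec n m) as [<-|Hnm].
  - rewrite Rmult_1_r. now apply P_norm.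
  - rewrite Rmult_0_r. destruct (le_ge_dec m n) as [h|h].
    + apply P_orthogonal; [exact Hk | lia].
    + refine (bilateral_ext _ _ _ _ _ _ (P_orthogonal k w n m Hk ltac:(lia))); [|reflexivity].
      intros s. ring.
Qed.

(** * Density of the spectral points *)

Definition lattice (beta x : R) : Prop := exists a b : Z, x = IZR a * beta + 2 * IZR b.

Lemma lattice_lin (beta x y : R) (m : Z) :
  lattice beta x -> lattice beta y -> lattice beta (x - IZR m * y).
Proof.
  intros [a [b ->]] [c [d ->]]. exists (a - m * c)%Z, (b - m * d)%Z.
  rewrite !minus_IZR, !mult_IZR. ring.
Qed.

Lemma euclid_remainder (x g : R) : 0 < g -> exists m : Z, 0 <= x - IZR m * g < g.
Proof.
  intros Hg. exists (Int_part (x / g)). destruct (base_Int_part (x / g)) as [H1 H2].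
  assert (E : x = x / g * g) by (field; lra).
  split; rewrite E at 1; nra.
Qed.

Lemma rational_of_ratio (beta : R) (p q : Z) :
  IZR q <> 0 -> IZR q * beta = 2 * IZR p -> ~ irrational beta.
Proof.
  intros Hq E Hirr. apply Hirr. destruct q as [|q|q]; [now elim Hq| |].
  - exists (Qmake (2 * p) q). change (beta = IZR (2 * p) * / IZR (Z.pos q)).
    rewrite mult_IZR, <- E. field. exact Hq.
  - exists (Qmake (- (2 * p)) q). change (beta = IZR (- (2 * p)) * / IZR (Z.pos q)).
    rewrite opp_IZR, mult_IZR, <- E. change (Z.neg q) with (- Z.pos q)%Z in *.
    rewrite opp_IZR in *. field. lra.
Qed.

(** Euclid's algorithm: as beta is irrational, beta and 2 are not both multiples of
    g, so one of them has a nonzero remainder r modulo g, and either r or g - r is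
    at most g/2. *)
Lemma lattice_halve (beta g : R) : irrational beta -> 0 < g -> lattice beta g ->
  exists h, 0 < h <= g / 2 /\ lattice beta h.
Proof.
  intros Hb Hg Lg.
  assert (Half : forall r, 0 < r < g -> lattice beta r -> exists h, 0 < h <= g / 2 /\ lattice beta h).
  { intros r Hr Lr. destruct (Rle_dec r (g / 2)) as [h|h].
    - exists r. split; [lra | exact Lr].
    - exists (g - IZR 1 * r). split; [lra | now apply lattice_lin]. }
  assert (Lb : lattice beta beta) by (exists 1%Z, 0%Z; ring).
  assert (L2 : lattice beta 2) by (exists 0%Z, 1%Z; ring).
  destruct (euclid_remainder beta g Hg) as [m Hm]. destruct (euclid_remainder 2 g Hg) as [p Hp].
  destruct (Req_dec (beta - IZR m * g) 0) as [Em|].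
  - destruct (Req_dec (2 - IZR p * g) 0) as [Ep|].
    + exfalso. apply (rational_of_ratio beta m p); [| |exact Hb].
      * intros h. rewrite h in Ep. lra.
      * replace beta with (IZR m * g) by lra. replace 2 with (IZR p * g) by lra. ring.
    + apply (Half (2 - IZR p * g)); [lra | now apply lattice_lin].
  - apply (Half (beta - IZR m * g)); [lra | now apply lattice_lin].
Qed.

Lemma lattice_small (beta e : R) : irrational beta -> 0 < e ->
  exists g, 0 < g < e /\ lattice beta g.
Proof.
  intros Hb He.
  assert (S : forall N, exists g, 0 < g <= 2 * (/ 2) ^ N /\ lattice beta g).
  { induction N as [|N [g [Hg Lg]]].
    - exists 2. split; [simpl; lra|]. exists 0%Z, 1%Z. ring.
    - destruct (lattice_halve beta g Hb (proj1 Hg) Lg) as [h [Hh Lh]].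
      exists h. split; [simpl; lra | exact Lh]. }
  (* The starting element 2 accounts for the factor e/2. *)
  destruct (pow_lt_1_zero (/ 2) ltac:(rewrite Rabs_right; lra) (e / 2) ltac:(lra)) as [N HN].
  specialize (HN N (le_n N)). rewrite Rabs_right in HN by (apply Rle_ge, pow_le; lra).
  destruct (S N) as [g [Hg Lg]]. exists g. split; [lra | exact Lg].
Qed.

Lemma cos_lipschitz (x y : R) : Rabs (cos x - cos y) <= Rabs (x - y).
Proof.
  destruct (MVT_gen cos y x (fun t => - sin t)) as [c [_ E]].
  - intros t _. apply is_derive_cos.
  - intros t _. apply continuity_cos.
  - rewrite E, Rabs_mult, Rabs_Ropp. pose proof (SIN_bound c).
    assert (Rabs (sin c) <= 1) by (unfold Rabs; destruct Rcase_abs; lra).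
    pose proof (Rabs_pos (x - y)). nra.
Qed.

Lemma cos_period_Z (x : R) (m : Z) : cos (x + 2 * (IZR m * PI)) = cos x.
Proof.
  assert (S : sin (IZR m * PI) = 0) by (apply sin_eq_0_1; now exists m).
  rewrite cos_plus, cos_2a_sin, sin_2a, S. ring.
Qed.

(** The angle of the node with index s is pi beta (s - 1/2) with beta = w/K. A
    multiple m g of a small element g = a beta + 2b of the group comes close to
    arccos(y)/pi + beta/2, and s = m a has the angle wanted up to the multiple 2 pi
    m b. *)
Lemma nodes_dense (k w : R) : 0 < k < 1 -> irrational (w / ellK k) ->
  dense_in (fun y : R => exists s : Z, y = node k w s) (fun y : R => -1 <= y <= 1).
Proof.
  intros Hk Hw. pose proof (ellK_pos k Hk) as HK. pose proof PI_RGT_0 as Hpi.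
  split.
  - intros y [s ->]. apply COS_bound.
  - intros y Hy V [e He].
    destruct (lattice_small (w / ellK k) (e / PI) Hw) as [g [Hg [a [b Eg]]]].
    { apply Rdiv_lt_0_compat; [apply cond_pos | exact Hpi]. }
    set (beta := w / ellK k) in *. set (phi := acos y).
    destruct (euclid_remainder (phi / PI + beta / 2) g (proj1 Hg)) as [m Hm].
    exists (node k w (m * a)). split; [|now exists (m * a)%Z].
    apply He. unfold disc. rewrite <- (cos_acos y Hy). fold phi.
    unfold node. rewrite <- (cos_period_Z _ (m * b)).
    eapply Rle_lt_trans; [apply cos_lipschitz|].
    replace (PI * w * (IZR (m * a) - / 2) / ellK k + 2 * (IZR (m * b) * PI) - phi)
      with (- (PI * (phi / PI + beta / 2 - IZR m * g))).
    2:{ rewrite Eg, !mult_IZR. unfold beta. field. lra. }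
    rewrite Rabs_Ropp, Rabs_right by nra.
    apply Rlt_le_trans with (PI * (e / PI)); [|right; field; lra].
    apply Rmult_lt_compat_l; lra.
Qed.

(** * The polynomials, their measure and its support *)

Theorem mainTheorem6 (k w : R) (hk : 0 < k < 1)
    (hw : irrational (w / ellK k)) :
  (forall (n : nat) (x : R),
     P k w n x =
     (-1) ^ n * powerRZ 2 (1 - Z.of_nat n) / (1 + dn k (2 * w * INR n))
     * (dn k (w * INR n) * ellbinom k w (2 * n) n
        + sum_n_m (fun s : nat =>
            (-1) ^ s * ellbinom k w (2 * n) (n + s)
            * (dn k (w * (INR n - INR s)) + dn k (w * (INR n + INR s)))
            * Cheb s x) 1 n)) /\
  (forall n m : nat,
     is_bilateral_series
       (fun s : Z =>
          weight k s * P k w n (node k w s) * P k w m (node k w s))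
       (Hnorm k w n * (if (n =? m)%nat then 1 else 0))) /\
  dense_in (fun y : R => exists s : Z, y = node k w s)
           (fun y : R => -1 <= y <= 1).
Proof.
  split; [|split].
  - intros n x. exact (P_explicit k w n x hk hw).
  - intros n m. exact (P_orthogonality k w n m hk).
  - exact (nodes_dense k w hk hw).
Qed.
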